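(* Let $(\mathbf{X},\mathbf{d})$ be a conditional metric space. Then there exists a conditionally complete conditional metric space $(\mathbf{X_c},\mathbf{d_c})$, unique up to conditional isometric isomorphism, such that $\mathbf{X}$ is conditionally isometric to a conditionally dense subset of $\mathbf{X_c}$.
   Context: Fix a complete non-degenerate Boolean algebra $\mathcal{A}=(\mathcal{A},\wedge,\vee,{}^c,0,1)$, with $a\le b$ iff $a\wedge b=a$. A partition is a family $(a_i)$ in $\mathcal{A}$ with $a_i\wedge a_j=0$ for $i\ne j$ and $\vee a_i=1$ (entries may be $0$). Conditional sets. A conditional set of a non-empty set $X$ and $\mathcal{A}$ is a collection $\mathbf{X}$ of objects $x|a$ ($x\in X$, $a\in\mathcal{A}$) such that (C1) $x|b=y|a$ implies $a=b$; (C2) $x|b=y|b$ and $a\le b$ imply $x|a=y|a$; (C3) for each partition $(a_i)$ and each family $(x_i)$ in $X$ there is a unique $x\in X$ with $x|a_i=x_i|a_i$ for all $i$; it is written $x=\sum x_i|a_i$ (concatenation). A subset $Y\subseteq X$ is stable if $Y\neq\emptyset$ and $\sum y_i|a_i\in Y$ for all families $(y_i)$ in $Y$ and partitions $(a_i)$; it induces the conditional subset $\mathbf{Y}=\{y|a:y\in Y,a\in\mathcal{A}\}$. Conditional elements $\mathbf{x}=\{x|a: a\in\mathcal{A}\}$ of $\mathbf{X}$ correspond to elements $x\in X$. Products carry componentwise concatenation. A function $f:X\to Y$ between sets inducing conditional sets is stable if $f(\sum x_i|a_i)=\sum f(x_i)|a_i$; conditional functions $\mathbf{f}:\mathbf{X}\to\mathbf{Y}$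 are those induced by stable functions. Step functions. For a non-empty set $E$, $E_s$ is the set of families $(x_i,a_i)$ in $E\times\mathcal{A}$ with $(a_i)$ a partition, where $(x_i,a_i)$ and $(y_j,b_j)$ are identified if $\vee\{a_i:x_i=z\}=\vee\{b_j:y_j=z\}$ for all $z\in E$; two classes agree on $a$ if these identities hold after meeting both sides with $a$. $E_s$ induces a conditional set, elements are written $\sum x_i|a_i$, and $E$ is embedded as the constants $x|1$. Conditional real numbers. On $\mathbb{R}_s$: $\sum x_i|a_i\leqslant\sum y_j|b_j$ (resp. $<$) iff $x_i\le y_j$ (resp. $x_i<y_j$) whenever $a_i\wedge b_j>0$; sum, product and absolute value are taken pointwise on the common refinement, e.g. $\sum x_i|a_i+\sum y_j|b_j=\sum (x_i+y_j)|a_i\wedge b_j$. $\mathbb{N}_s\subseteq\mathbb{R}_s$ carries the inherited order. A conditional sequence in $\mathbf{X}$ is a stable function $\mathbb{N}_s\to X$, $n\mapsto x_n$. The conditional real numbers $\mathbf{R}$ are induced by the set $R$ of conditional Cauchy sequences $(x_n)$ in $\mathbb{R}_s$ (for every $r\in\mathbb{R}_s$, $r>0$, there is $n_0\in\mathbb{N}_s$ with $|x_m-x_n|<r$ for all $m,n\geqslant n_0$), with $(x_n),(y_n)$ identified if $|x_n-y_n|$ converges to $0$ (for every $r\in\mathbb{R}_s$, $r>0$, there is $n_0\in\mathbb{N}_s$ with $|x_n-y_n|<r$ for all $n\geqslant n_0$; agreement on $a$ is the same condition with the inequality required on $a$ only). Operations and concatenations are defined representative-wise. $[(x_n)]\leqslant[(y_n)]$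 iff for all $r\in\mathbb{R}_s$, $r>0$, there is $n\in\mathbb{N}_s$ with $y_m-x_m>-r$ for all $m\geqslant n$; $[(x_n)]<[(y_n)]$ iff there are $r\in\mathbb{R}_s$, $r>0$, and $n\in\mathbb{N}_s$ with $y_m-x_m>r$ for all $m\geqslant n$. $R_+=\{x\in R:x\geqslant0\}$, $R_{++}=\{x\in R:x>0\}$. Conditional metric spaces. A conditional metric $\mathbf{d}:\mathbf{X}\times\mathbf{X}\to\mathbf{R}_+$ is a conditional function (induced by a stable function $d:X\times X\to R_+$) with $d(x,y)=0$ iff $x=y$, $d(x,y)=d(y,x)$, and $d(x,y)\leqslant d(x,z)+d(z,y)$ for all $x,y,z\in X$. A conditional sequence $(x_n)$ is conditionally Cauchy if for each $r\in R_{++}$ there is $n_0\in\mathbb{N}_s$ with $d(x_m,x_n)<r$ for all $m,n\geqslant n_0$, and has conditional limit $x$ if for each $r\in R_{++}$ there is $n_0\in\mathbb{N}_s$ with $d(x_n,x)<r$ for all $n\geqslant n_0$. The space is conditionally complete if every conditional Cauchy sequence has a conditional limit. A conditional subset induced by a stable $Y\subseteq X$ is conditionally dense if for every $x\in X$ and $r\in R_{++}$ there is $y\in Y$ with $d(x,y)<r$. A conditional isometry is a conditional function preserving the conditional metrics; a conditional isometric isomorphism is a surjective (hence bijective) conditional isometry; two conditional metric spaces are conditionally isometric if there is a conditional isometric isomorphism between them. *)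

(* Defs.v *)
From HB Require Import structures.
From mathcomp Require Import all_boot all_order all_algebra.
From mathcomp Require Import boolp classical_sets reals.
From mathcomp Require Import ring lra.

Set Implicit Arguments.
Unset Strict Implicit.
Unset Printing Implicit Defensive.
Import Order.Theory GRing.Theory Num.Theory.
Local Open Scope ring_scope.
Local Open Scope order_scope.

Record cbalg := CBAlg {
  cbalg_disp : Order.disp_t;
  cbalg_sort :> ctbDistrLatticeType cbalg_disp;
  cbalg_complete : forall S : set cbalg_sort, exists m, isLub S m;
  cbalg_nondegenerate : (\bot : cbalg_sort) <> \top }.

(* Families indexed by an arbitrary set I; entries may be \bot. *)
Record bpartition (A : cbalg) (I : Type) := Partition {
  part_fun :> I -> A;
  part_disj : forall i j, i <> j -> part_fun i `&` part_fun j = \bot;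
  part_cover : isLub (range part_fun) \top }.

Section BooleanFacts.
Variable A : cbalg.
Implicit Types a b c : A.

Definition bsup (S : set A) : A := sval (cid (cbalg_complete S)).

Lemma bsupP (S : set A) : isLub S (bsup S).
Proof. exact: (svalP (cid (cbalg_complete S))). Qed.

Lemma bsup_ub (S : set A) a : S a -> a <= bsup S.
Proof. by move=> Sa; have [+ _] := bsupP S; apply. Qed.

Lemma lub_meet (S : set A) m c : isLub S m -> \bot < c -> c <= m ->
  exists2 s, S s & \bot < c `&` s.
Proof.
move=> [_ lubS] c0 cm; apply: contrapT => noS.
suff : m <= ~` c.
  move=> mc; have : c `&` c == \bot by rewrite disj_leC (le_trans cm mc).
  by rewrite meetxx => /eqP c0'; rewrite c0' ltxx in c0.
apply: lubS => s Ss; rewrite -disj_leC meetC.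
by apply: contraT => cs; exfalso; apply: noS; exists s; rewrite // lt0x.
Qed.

Lemma le_dense b c :
  (forall a, \bot < a -> a <= b -> exists d, [/\ \bot < d, d <= a & d <= c]) ->
  b <= c.
Proof.
move=> H; apply: contraT => nbc.
have p : \bot < b `&` ~` c by rewrite lt0x disj_leC complK.
have [d [d0 da dc]] := H _ p (leIl _ _).
have : d <= c `&` ~` c by rewrite lexI dc (le_trans da (leIr _ _)).
by rewrite meetxC lex0 => /eqP d0'; rewrite d0' ltxx in d0.
Qed.

Lemma part_ext I (a b : bpartition A I) : (forall i, a i = b i) -> a = b.
Proof.
case: a b => [a a1 a2] [b b1 b2] /= /funext ab; subst b.
by rewrite (Prop_irrelevance a1 b1) (Prop_irrelevance a2 b2).
Qed.

Lemma part_eval I (x : bpartition A I) b : \bot < b ->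
  exists i c, [/\ \bot < c, c <= b & c <= x i].
Proof.
move=> b0; have [_ [i _ <-] p] := lub_meet (part_cover x) b0 (lex1 _).
by exists i, (b `&` x i); rewrite leIl leIr.
Qed.

Lemma part_inj I (x : bpartition A I) b i j :
  \bot < b -> b <= x i -> b <= x j -> i = j.
Proof.
move=> b0 bi bj; apply: contrapT => /(part_disj x) e.
have : b <= x i `&` x j by rewrite lexI bi.
by rewrite e lex0 => /eqP b0'; rewrite b0' ltxx in b0.
Qed.

Lemma lub1 (S : set A) :
  (forall b, \bot < b -> exists2 s, S s & \bot < b `&` s) -> isLub S \top.
Proof.
move=> H; split=> [s _|m ubm]; first exact: lex1.
apply: le_dense => a a0 _; have [s Ss p] := H _ a0.
by exists (a `&` s); rewrite leIl (le_trans (leIr _ _) (ubm _ Ss)).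
Qed.

End BooleanFacts.

Section Partitions.
Variable A : cbalg.
Implicit Types a b c : A.

Fact part_prod_disj I J (a : bpartition A I) (b : I -> bpartition A J)
    (p q : I * J) : p <> q ->
  (a p.1 `&` b p.1 p.2) `&` (a q.1 `&` b q.1 q.2) = \bot.
Proof.
case: p q => [i j] [k l] /= ne; apply/eqP; rewrite -lex0.
have [ik|ik] := pselect (i = k); last by
  rewrite -(part_disj a ik) leI2 ?leIl.
subst k; have jl : j <> l by move=> e; apply: ne; rewrite e.
by rewrite -(part_disj (b i) jl) leI2 ?leIr.
Qed.

Fact part_prod_cover I J (a : bpartition A I) (b : I -> bpartition A J) :
  isLub (range (fun p : I * J => a p.1 `&` b p.1 p.2)) \top.
Proof.
apply: lub1 => c c0.
have [i [d [d0 dc di]]] := part_eval a c0.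
have [j [e [e0 ed ej]]] := part_eval (b i) d0.
exists (a i `&` b i j); first by exists (i, j).
by apply: lt_le_trans e0 _; rewrite !lexI ej (le_trans ed di) (le_trans ed dc).
Qed.

Definition part_prod I J (a : bpartition A I) (b : I -> bpartition A J) :=
  Partition (@part_prod_disj I J a b) (part_prod_cover a b).

Fact part_unit_disj (i j : unit) : i <> j -> \top `&` \top = \bot :> A.
Proof. by case: i j => -[]. Qed.

Fact part_unit_cover : isLub (range (fun _ : unit => \top : A)) \top.
Proof.
by apply: lub1 => c c0; exists \top; [exists tt|rewrite meetx1].
Qed.

Definition part_unit := Partition part_unit_disj part_unit_cover.

Fact part_bool_disj a (i j : bool) : i <> j ->
  (if i then a else ~` a) `&` (if j then a else ~` a) = \bot.
Proof. by case: i j => [] [] //= _; rewrite ?meetxC ?meetCx. Qed.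

Fact part_bool_cover a :
  isLub (range (fun t : bool => if t then a else ~` a)) \top.
Proof.
apply: lub1 => c c0.
have [ca|ca] := boolP (c `&` a == \bot).
  exists (~` a); first by exists false.
  by rewrite disj_leC in ca; rewrite (meet_idPl ca).
by exists a; [exists true|rewrite lt0x].
Qed.

Definition part_bool a := Partition (@part_bool_disj a) (part_bool_cover a).

End Partitions.

(* [restr x a] is the object x|a.  The object type may contain elements that
   are not of this form; the conditional set is the range of [restr]. *)
Record condset (A : cbalg) := CondSet {
  cs_sort :> Type;
  cs_inhabited : inhabited cs_sort;
  cs_obj : Type;
  restr : cs_sort -> A -> cs_obj;
  restr_inj : forall x y a b, restr x a = restr y b -> a = b;
  restr_le : forall x y a b, a <= b ->
    restr x b = restr y b -> restr x a = restr y a;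
  restr_glue : forall (I : Type) (a : bpartition A I) (x : I -> cs_sort),
    exists! y, forall i, restr y (a i) = restr (x i) (a i) }.

Definition concat (A : cbalg) (X : condset A) (I : Type) (a : bpartition A I)
  (x : I -> X) : X := sval (cid (restr_glue a x)).

Definition stable (A : cbalg) (X Y : condset A) (f : X -> Y) :=
  forall (I : Type) (a : bpartition A I) (x : I -> X),
    f (concat a x) = concat a (fun i => f (x i)).

Definition stable_subset (A : cbalg) (X : condset A) (Y : set X) :=
  (exists y, Y y) /\
  forall (I : Type) (a : bpartition A I) (x : I -> X),
    (forall i, Y (x i)) -> Y (concat a x).

Section CondSetFacts.
Variable A : cbalg.
Implicit Types (X Y : condset A) (a b : A).

Lemma concatP X I (a : bpartition A I) (x : I -> X) i :
  restr (concat a x) (a i) = restr (x i) (a i).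
Proof. by have [+ _] := svalP (cid (restr_glue a x)); apply. Qed.

Lemma concat_uniq X I (a : bpartition A I) (x : I -> X) y :
  (forall i, restr y (a i) = restr (x i) (a i)) -> y = concat a x.
Proof.
by move=> H; have [_ /(_ _ H)] := svalP (cid (restr_glue a x)).
Qed.

Lemma concat_cst X I (a : bpartition A I) (y : X) : concat a (fun=> y) = y.
Proof. by symmetry; apply: concat_uniq. Qed.

Lemma stableP X Y (f : X -> Y) : stable f <->
  forall x y a, restr x a = restr y a -> restr (f x) a = restr (f y) a.
Proof.
split=> [sf x y a xy|lf I a x]; last first.
  by apply: concat_uniq => i; apply: lf; exact: concatP.
have ey : y = concat (part_bool a) (fun t : bool => if t then x else y).
  by apply: concat_uniq => -[].
by rewrite ey sf (concatP (part_bool a) _ true).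
Qed.

End CondSetFacts.

(* Conditional sets given by the relations "x|a = y|a". *)
Section OfAgree.
Variables (A : cbalg) (X : Type) (agree : A -> X -> X -> Prop).
Hypothesis X_inh : inhabited X.
Hypothesis agree_refl : forall a x, agree a x x.
Hypothesis agree_sym : forall a x y, agree a x y -> agree a y x.
Hypothesis agree_trans :
  forall a x y z, agree a x y -> agree a y z -> agree a x z.
Hypothesis agree_le :
  forall a b x y, a <= b -> agree b x y -> agree a x y.
Hypothesis agree_glue :
  forall (I : Type) (a : bpartition A I) (x : I -> X),
    exists! y, forall i, agree (a i) y (x i).

Let r (x : X) (a : A) : A * set X := (a, agree a x).

Fact of_agreeE x y a : r x a = r y a <-> agree a x y.
Proof.
split=> [[] e|xy].
  by move: (agree_refl a y); rewrite -e.
congr pair; apply/funext => z; apply/propext; split; first exact/agree_trans/agree_sym.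
exact: agree_trans.
Qed.

Fact of_agree_inj x y a b : r x a = r y b -> a = b.
Proof. by case. Qed.

Fact of_agree_le x y a b : a <= b -> r x b = r y b -> r x a = r y a.
Proof. by move=> ab /of_agreeE xy; apply/of_agreeE; exact: agree_le xy. Qed.

Fact of_agree_glue (I : Type) (a : bpartition A I) (x : I -> X) :
  exists! y, forall i, r y (a i) = r (x i) (a i).
Proof.
have [y [yx yu]] := agree_glue a x; exists y; split.
  by move=> i; apply/of_agreeE.
by move=> z zx; apply: yu => i; apply/of_agreeE.
Qed.

Definition condset_of_agree : condset A :=
  CondSet X_inh of_agree_inj of_agree_le of_agree_glue.

Lemma condset_of_agreeE (x y : condset_of_agree) a :
  restr x a = restr y a <-> agree a x y.
Proof. exact: of_agreeE. Qed.

End OfAgree.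

Section Product.
Variables (A : cbalg) (X Y : condset A).

Let r (p : X * Y) (a : A) := (restr p.1 a, restr p.2 a).

Fact prod_inh : inhabited (X * Y).
Proof. by case: (cs_inhabited X) (cs_inhabited Y) => x [y]. Qed.

Fact prod_restr_inj p q a b : r p a = r q b -> a = b.
Proof. by case=> /restr_inj. Qed.

Fact prod_restr_le p q a b : a <= b -> r p b = r q b -> r p a = r q a.
Proof.
by move=> ab [] e1 e2; congr pair; [apply: restr_le e1|apply: restr_le e2].
Qed.

Fact prod_glue (I : Type) (a : bpartition A I) (p : I -> X * Y) :
  exists! q, forall i, r q (a i) = r (p i) (a i).
Proof.
exists (concat a (fun i => (p i).1), concat a (fun i => (p i).2)); split.
  by move=> i; rewrite /r !concatP.
move=> [x y] e; congr pair; symmetry; apply: concat_uniq => i;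
  by case: (e i).
Qed.

Definition condprod : condset A :=
  CondSet prod_inh prod_restr_inj prod_restr_le prod_glue.

End Product.

Section Subset.
Variables (A : cbalg) (X : condset A) (Y : set X) (sY : stable_subset Y).

Let r (y : {y : X | Y y}) (a : A) := restr (sval y) a.

Fact sub_inh : inhabited {y : X | Y y}.
Proof. by case: sY => -[y Yy] _; exists; exists y. Qed.

Fact sub_restr_inj x y a b : r x a = r y b -> a = b.
Proof. exact: restr_inj. Qed.

Fact sub_restr_le x y a b : a <= b -> r x b = r y b -> r x a = r y a.
Proof. exact: restr_le. Qed.

Fact sub_glue (I : Type) (a : bpartition A I) (x : I -> {y : X | Y y}) :
  exists! y, forall i, r y (a i) = r (x i) (a i).
Proof.
have Yc : Y (concat a (fun i => sval (x i))).
  by apply: sY.2 => i; exact: (svalP (x i)).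
exists (exist _ _ Yc); split=> [i|[z Yz] e]; first by rewrite /r concatP.
by apply: eq_exist; symmetry; exact: concat_uniq.
Qed.

Definition condsub : condset A :=
  CondSet sub_inh sub_restr_inj sub_restr_le sub_glue.

Lemma val_concat (I : Type) (a : bpartition A I) (x : I -> condsub) :
  sval (concat a x) = concat a (fun i => sval (x i)).
Proof. by apply: concat_uniq => i; exact: (concatP a x i). Qed.

End Subset.

(* The class of a family (x_i, a_i) is determined by the partition
   z |-> \/ {a_i : x_i = z} indexed by E, and every partition indexed by E
   arises in this way (from itself), so it serves as a normal form. *)
Definition step (A : cbalg) (E : Type) := bpartition A E.

Section Step.
Variable A : cbalg.
Implicit Types a b c : A.

Section StepOf.
Variables (E I : Type) (x : I -> E) (a : bpartition A I).

Let val z := bsup [set a i | i in [set i | x i = z]].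

Let val_force z b : \bot < b -> b <= val z ->
  exists i c, [/\ \bot < c, c <= b, c <= a i & x i = z].
Proof.
move=> b0 bz; have [_ [i iz <-] p] := lub_meet (bsupP _) b0 bz.
by exists i, (b `&` a i); rewrite leIl leIr.
Qed.

Let val_ge i : a i <= val (x i).
Proof. by apply: bsup_ub; exists i. Qed.

Fact step_of_disj z w : z <> w -> val z `&` val w = \bot.
Proof.
move=> ne; apply/eqP; apply: contraT; rewrite -lt0x => p; exfalso; apply: ne.
have [i [c [c0 cb ci <-]]] := val_force p (leIl _ _).
have cw : c <= val w by apply: le_trans cb (leIr _ _).
have [j [d [d0 dc dj <-]]] := val_force c0 cw.
by rewrite (part_inj d0 (le_trans dc ci) dj).
Qed.

Fact step_of_cover : isLub (range val) \top.
Proof.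
apply: lub1 => b b0; have [i [c [c0 cb ci]]] := part_eval a b0.
exists (val (x i)); first by exists (x i).
by apply: lt_le_trans c0 _; rewrite lexI cb (le_trans ci (val_ge i)).
Qed.

(* The step function  \sum x_i | a_i. *)
Definition step_of : step A E := Partition step_of_disj step_of_cover.

Lemma step_of_force z b : \bot < b -> b <= step_of z ->
  exists i c, [/\ \bot < c, c <= b, c <= a i & x i = z].
Proof. exact: val_force. Qed.

Lemma step_of_ge i : a i <= step_of (x i).
Proof. exact: val_ge. Qed.

End StepOf.

Lemma step_of_id E (x : step A E) : step_of id x = x.
Proof.
apply: part_ext => z; apply: le_anti; rewrite (step_of_ge id) andbT.
apply: le_dense => b b0 bz; have [i [c [c0 cb ci <-]]] := step_of_force b0 bz.
by exists c.
Qed.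

Lemma step_of_eq E I J (x : I -> E) (a : bpartition A I) (y : J -> E)
    (b : bpartition A J) :
  step_of x a = step_of y b <->
  forall z, bsup [set a i | i in [set i | x i = z]] =
            bsup [set b j | j in [set j | y j = z]].
Proof.
split=> [e z|H]; last exact: part_ext.
exact: (congr1 (fun s : step A E => s z) e).
Qed.

Definition step_agree E a (x y : step A E) :=
  forall z, x z `&` a = y z `&` a.

Lemma step_agreeP E a (x y : step A E) : step_agree a x y <->
  forall b z, \bot < b -> b <= a -> b <= x z -> b <= y z.
Proof.
split=> [e b z b0 ba bx|H z].
  have : b <= x z `&` a by rewrite lexI bx.
  by rewrite e lexI => /andP[].
apply: le_anti; rewrite !lexI !leIr !andbT; apply/andP; split.
  apply: le_dense => b b0; rewrite lexI => /andP[bx ba].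
  by exists b; split=> //; apply: H.
apply: le_dense => b b0; rewrite lexI => /andP[by_ ba].
have [u [c [c0 cb cu]]] := part_eval x b0; exists c; split=> //.
have cy := H _ _ c0 (le_trans cb ba) cu.
by rewrite (part_inj c0 (le_trans cb by_) cy).
Qed.

Fact step_agree_glue E (I : Type) (a : bpartition A I) (x : I -> step A E) :
  exists! y, forall i, step_agree (a i) y (x i).
Proof.
exists (step_of snd (part_prod a x)); split=> [i|y yx].
  apply/step_agreeP => b z b0 ba bz; apply: le_dense => c c0 cb.
  have [[j u] [d [d0 dc]]] := step_of_force c0 (le_trans cb bz).
  rewrite /= lexI => /andP[dj du] eu; subst u; exists d; split=> //.
  by rewrite (part_inj d0 (le_trans (le_trans dc cb) ba) dj).
apply: part_ext => z; symmetry; apply: le_anti; apply/andP; split.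
  apply: le_dense => b b0 bz; have [i [c [c0 cb ci]]] := part_eval a b0.
  exists c; split=> //.
  have /step_agreeP/(_ c z c0 ci (le_trans cb bz)) cx := yx i.
  apply: le_trans (step_of_ge snd (part_prod a x) (i, z)).
  by rewrite /= lexI ci.
apply: le_dense => b b0 bz.
have [[i u] [c [c0 cb]]] := step_of_force b0 bz.
rewrite /= lexI => /andP[ci cu] eu; subst u; exists c; split=> //.
have : c <= x i z `&` a i by rewrite lexI cu.
by rewrite -yx lexI => /andP[].
Qed.

Definition step_cst E (z : E) : step A E := step_of (fun=> z) (part_unit A).

Lemma step_cst_ge E (z : E) b : b <= step_cst z z.
Proof.
by apply: le_trans (step_of_ge (fun=> z) (part_unit A) tt); exact: lex1.
Qed.

Fact step_agree_trans E a (x y z : step A E) :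
  step_agree a x y -> step_agree a y z -> step_agree a x z.
Proof. by move=> xy yz u; rewrite xy. Qed.

Fact step_agree_le E a b (x y : step A E) :
  a <= b -> step_agree b x y -> step_agree a x y.
Proof.
move=> ab /step_agreeP xy; apply/step_agreeP => c z c0 ca.
by apply: xy => //; exact: le_trans ca ab.
Qed.

(* The conditional set of step functions on E; [e] witnesses that E is not
   empty. *)
Definition condstep (E : Type) (e : E) : condset A :=
  @condset_of_agree A (step A E) (@step_agree E) (inhabits (step_cst e))
    (fun a x z => erefl) (fun a x y xy z => esym (xy z))
    (@step_agree_trans E) (@step_agree_le E) (@step_agree_glue E).

Lemma condstepE E (e : E) (x y : condstep e) a :
  restr x a = restr y a <-> step_agree a x y.
Proof. exact: condset_of_agreeE. Qed.

Lemma concat_stepE E (e : E) I (a : bpartition A I) (x : I -> condstep e)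
    i b z : \bot < b -> b <= a i ->
  (b <= (concat a x : step A E) z) = (b <= (x i : step A E) z).
Proof.
move=> b0 bi; have /condstepE e1 := concatP a x i.
have e2 : step_agree (a i) (x i) (concat a x) by move=> u.
by apply/idP/idP; [move/step_agreeP: e1|move/step_agreeP: e2]; apply.
Qed.

Definition step_map E F (f : E -> F) (x : step A E) : step A F := step_of f x.

(* \sum f x_i y_j | a_i /\ b_j *)
Definition step_map2 E F G (f : E -> F -> G) (x : step A E) (y : step A F) :
    step A G :=
  step_of (fun p => f p.1 p.2) (part_prod x (fun=> y)).

Lemma step_map_ge E F (f : E -> F) (x : step A E) b u :
  b <= x u -> b <= step_map f x (f u).
Proof. by move=> bu; apply: le_trans (step_of_ge f x u). Qed.

Lemma step_map2_ge E F G (f : E -> F -> G) (x : step A E) (y : step A F)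
    b u v :
  b <= x u -> b <= y v -> b <= step_map2 f x y (f u v).
Proof.
move=> bu bv.
apply: le_trans (step_of_ge (fun p => f p.1 p.2) (part_prod x (fun=> y)) (u, v)).
by rewrite /= lexI bu.
Qed.

(* [P x_i y_j] whenever [a_i /\ b_j /\ a > 0]: the relation [P] between step
   functions, required on [a] only. *)
Definition step_rel_on E F (P : E -> F -> Prop) a (x : step A E)
    (y : step A F) :=
  forall u v, \bot < x u `&` y v `&` a -> P u v.

Lemma step_relP E F (P : E -> F -> Prop) a (x : step A E) (y : step A F) :
  step_rel_on P a x y <->
  forall b u v, \bot < b -> b <= a -> b <= x u -> b <= y v -> P u v.
Proof.
split=> [H b u v b0 ba bu bv|H u v p].
  by apply: H; apply: lt_le_trans b0 _; rewrite !lexI bu bv.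
apply: (H _ _ _ p); first exact: leIr.
  by rewrite -meetA leIl.
by rewrite -meetA meetCA leIl.
Qed.

Definition step_rel E F (P : E -> F -> Prop) (x : step A E) (y : step A F) :=
  forall u v, \bot < x u `&` y v -> P u v.

Lemma step_rel_top E F (P : E -> F -> Prop) (x : step A E) (y : step A F) :
  step_rel P x y <-> step_rel_on P \top x y.
Proof. by split=> H u v; move: (H u v); rewrite meetx1. Qed.

(* Independence of the families representing the two step functions. *)
Lemma step_rel_of E F I J (P : E -> F -> Prop) (x : I -> E)
    (a : bpartition A I) (y : J -> F) (b : bpartition A J) :
  step_rel P (step_of x a) (step_of y b) <->
  forall i j, \bot < a i `&` b j -> P (x i) (y j).
Proof.
split=> [H i j p|H u v p].
  by apply: H; apply: lt_le_trans p _; rewrite leI2 ?step_of_ge.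
have [i [c [c0 cp ci <-]]] := step_of_force p (leIl _ _).
have [j [d [d0 dc dj <-]]] := step_of_force c0 (le_trans cp (leIr _ _)).
by apply: H; apply: lt_le_trans d0 _; rewrite lexI dj (le_trans dc ci).
Qed.

Lemma step_ext E (x y : step A E) :
  (forall b z, \bot < b -> b <= x z ->
     exists d, [/\ \bot < d, d <= b & d <= y z]) -> x = y.
Proof.
move=> H; apply: part_ext => z.
have /step_agreeP e : forall b z, \bot < b -> b <= \top -> b <= x z -> b <= y z.
  move=> b u b0 _ bu; apply: le_dense => c c0 cb.
  by apply: H => //; exact: le_trans cb bu.
by move: (e z); rewrite !meetx1.
Qed.

Lemma step_map_of E F I (f : E -> F) (x : I -> E) (a : bpartition A I) :
  step_map f (step_of x a) = step_of (fun i => f (x i)) a.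
Proof.
apply: step_ext => b z b0 bz.
have [u [c [c0 cb cu <-]]] := step_of_force b0 bz.
have [i [d [d0 dc di <-]]] := step_of_force c0 cu.
exists d; split=> //; first exact: le_trans dc cb.
exact: le_trans di (step_of_ge (fun i => f (x i)) a i).
Qed.

Lemma step_map2_of E F G I J (f : E -> F -> G) (x : I -> E)
    (a : bpartition A I) (y : J -> F) (b : bpartition A J) :
  step_map2 f (step_of x a) (step_of y b) =
  step_of (fun p => f (x p.1) (y p.2)) (part_prod a (fun=> b)).
Proof.
apply: step_ext => w z w0 wz.
have [[u v] [c [c0 cw]]] := step_of_force w0 wz.
rewrite /= lexI => /andP[cu cv] <-.
have [i [d [d0 dc di <-]]] := step_of_force c0 cu.
have [j [e [e0 ed ej <-]]] := step_of_force d0 (le_trans dc cv).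
exists e; split=> //; first exact: le_trans ed (le_trans dc cw).
apply: le_trans (step_of_ge (fun p => f (x p.1) (y p.2))
  (part_prod a (fun=> b)) (i, j)).
by rewrite /= lexI ej (le_trans ed di).
Qed.

End Step.

Definition condnat (A : cbalg) : condset A := condstep A 0%N.

(* The order inherited from the step functions with real values. *)
Definition nle (A : cbalg) (m n : condnat A) :=
  step_rel (fun i j : nat => (i <= j)%N) m n.

Record condseq (A : cbalg) (X : condset A) := CondSeq {
  seq_fun :> condnat A -> X;
  seq_stable : stable seq_fun }.

Section ConditionalReals.
Variables (R : realType) (A : cbalg).
Implicit Types (a b c : A) (m n : condnat A).

Definition stepreal : condset A := condstep A (0 : R)%R.
Implicit Types x y z r : stepreal.

Definition slt x y := step_rel (fun u v : R => (u < v)%R) x y.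
Definition slt_on a x y := step_rel_on (fun u v : R => (u < v)%R) a x y.

Definition scst (u : R) : stepreal := step_cst A u.
Definition sadd x y : stepreal := step_map2 (fun u v : R => u + v)%R x y.
Definition sopp x : stepreal := step_map (fun u : R => - u)%R x.
Definition snorm x : stepreal := step_map (fun u : R => `|u|)%R x.
Definition ssub x y : stepreal := sadd x (sopp y).

Definition step_cauchy (x : condseq stepreal) :=
  forall r, slt (scst 0%R) r -> exists n0, forall m n,
    nle n0 m -> nle n0 n -> slt (snorm (ssub (x m) (x n))) r.

Record cauchyseq := CauchySeq {
  cauchyseq_seq :> condseq stepreal;
  cauchyseqP : step_cauchy cauchyseq_seq }.

(* [|x_n - y_n|] converges to 0 on [a] *)
Definition cauchy_agree a (x y : cauchyseq) :=
  forall r, slt (scst 0%R) r -> exists n0, forall n,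
    nle n0 n -> slt_on a (snorm (ssub (x n) (y n))) r.

Definition cauchy_le (x y : cauchyseq) :=
  forall r, slt (scst 0%R) r -> exists n, forall m,
    nle n m -> slt (sopp r) (ssub (y m) (x m)).

Definition cauchy_lt (x y : cauchyseq) :=
  exists2 r, slt (scst 0%R) r & exists n, forall m,
    nle n m -> slt r (ssub (y m) (x m)).

Lemma sltP x y : slt x y <-> forall b (u v : R), \bot < b ->
  b <= (x : step A R) u -> b <= (y : step A R) v -> (u < v)%R.
Proof.
rewrite /slt step_rel_top step_relP; split=> H b u v b0; last by move=> _; apply: H.
by apply: H => //; exact: lex1.
Qed.

Lemma nleP m n : nle m n <-> forall b (i j : nat), \bot < b ->
  b <= (m : step A nat) i -> b <= (n : step A nat) j -> (i <= j)%N.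
Proof.
rewrite /nle step_rel_top step_relP; split=> H b u v b0; last by move=> _; apply: H.
by apply: H => //; exact: lex1.
Qed.

Lemma dist_ltP a x y r : slt_on a (snorm (ssub x y)) r <->
  forall b (u v t : R), \bot < b -> b <= a -> b <= (x : step A R) u ->
    b <= (y : step A R) v -> b <= (r : step A R) t -> (`|u - v| < t)%R.
Proof.
rewrite /slt_on step_relP; split=> [H b u v t b0 ba bu bv bt|H b s t b0 ba bs bt].
  by apply: (H b) => //; apply: step_map_ge; apply: step_map2_ge => //;
     exact: step_map_ge.
have [w [c [c0 cb cw <-]]] := step_of_force b0 bs.
have [[u v'] [d [d0 dc]]] := step_of_force c0 cw.
rewrite /= lexI => /andP[du dv'] <-.
have [v [e [e0 ed ev <-]]] := step_of_force d0 dv'.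
have eb : e <= b by apply: le_trans ed (le_trans dc cb).
apply: (H e) => //; [exact: le_trans eb ba|exact: le_trans ed du|].
exact: le_trans eb bt.
Qed.

Lemma slt_top x y : slt x y <-> slt_on \top x y.
Proof. exact: step_rel_top. Qed.

Lemma slt0P r : slt (scst 0%R) r <->
  forall b (t : R), \bot < b -> b <= (r : step A R) t -> (0 < t)%R.
Proof.
rewrite sltP; split=> [H b t b0 bt|H b u t b0 bu bt].
  by apply: (H b) => //; exact: step_cst_ge.
by rewrite (part_inj b0 bu (step_cst_ge 0%R b)); exact: H bt.
Qed.

Lemma nle_refl n : nle n n.
Proof. by apply/nleP => b i j b0 bi bj; rewrite (part_inj b0 bi bj). Qed.
Arguments nle_refl n : clear implicits.

Lemma nle_trans n m p : nle m n -> nle n p -> nle m p.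
Proof.
move=> /nleP mn /nleP np; apply/nleP => b i j b0 bi bj.
have [k [c [c0 cb ck]]] := part_eval (n : step A nat) b0.
exact: leq_trans (mn _ _ _ c0 (le_trans cb bi) ck)
  (np _ _ _ c0 ck (le_trans cb bj)).
Qed.
Arguments nle_trans [n m p] _ _.

Definition nmax m n : condnat A := step_map2 maxn m n.

Lemma nmaxC m n : nmax m n = nmax n m.
Proof.
have H (p q : condnat A) b (z : nat) : \bot < b -> b <= (nmax p q : step A nat) z ->
    exists d, [/\ \bot < d, d <= b & d <= (nmax q p : step A nat) z].
  move=> b0 bz; have [[i j] [c [c0 cb]]] := step_of_force b0 bz.
  rewrite /= lexI => /andP[ci cj] <-; exists c; split=> //.
  by rewrite maxnC; exact: step_map2_ge.
by apply: step_ext => b z; exact: H.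
Qed.

Lemma nle_maxl m n : nle m (nmax m n).
Proof.
apply/nleP => b i j b0 bi bj.
have [[k l] [c [c0 cb]]] := step_of_force b0 bj.
rewrite /= lexI => /andP[ck _] <-.
by rewrite (part_inj c0 (le_trans cb bi) ck) leq_maxl.
Qed.
Arguments nle_maxl m n : clear implicits.

Lemma nle_maxr m n : nle n (nmax m n).
Proof. by rewrite nmaxC; exact: nle_maxl. Qed.
Arguments nle_maxr m n : clear implicits.

Definition shalf r : stepreal := step_map (fun u : R => u / 2)%R r.

Lemma shalf_gt0 r : slt (scst 0%R) r -> slt (scst 0%R) (shalf r).
Proof.
move=> /slt0P r0; apply/slt0P => b t b0 bt.
have [u [c [c0 cb cu <-]]] := step_of_force b0 bt.
by have := r0 _ _ c0 cu; lra.
Qed.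
Arguments shalf_gt0 [r] _.

Lemma dist_triangle a x y z r :
  slt_on a (snorm (ssub x y)) (shalf r) ->
  slt_on a (snorm (ssub y z)) (shalf r) -> slt_on a (snorm (ssub x z)) r.
Proof.
move=> /dist_ltP xy /dist_ltP yz; apply/dist_ltP => b u w t b0 ba bu bw bt.
have [v [c [c0 cb cv]]] := part_eval (y : step A R) b0.
have ct : c <= (shalf r : step A R) (t / 2)%R.
  by apply: step_map_ge; exact: le_trans cb bt.
have h1 := xy _ _ _ _ c0 (le_trans cb ba) (le_trans cb bu) cv ct.
have h2 := yz _ _ _ _ c0 (le_trans cb ba) cv (le_trans cb bw) ct.
by have := ler_distD v u w; lra.
Qed.
Arguments dist_triangle [a x y z r] _ _.

Lemma dist_sym a x y r :
  slt_on a (snorm (ssub x y)) r -> slt_on a (snorm (ssub y x)) r.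
Proof.
move=> /dist_ltP xy; apply/dist_ltP => b u v t b0 ba bu bv bt.
by rewrite distrC; exact: (xy b).
Qed.
Arguments dist_sym [a x y r] _.

Lemma slt_on_le a b x y : a <= b -> slt_on b x y -> slt_on a x y.
Proof.
rewrite /slt_on !step_relP => ab H c u v c0 ca.
by apply: H => //; exact: le_trans ca ab.
Qed.
Arguments slt_on_le [a b x y] _ _.

Lemma seq_local (x : condseq stepreal) m n a b (u : R) :
  step_agree a m n -> \bot < b -> b <= a ->
  b <= (x m : step A R) u -> b <= (x n : step A R) u.
Proof.
move=> mn; have /stableP sx := seq_stable x.
have /condstepE/step_agreeP xmn : restr (x m) a = restr (x n) a.
  by apply: sx; apply/condstepE.
exact: xmn.
Qed.

Lemma cauchy_agree_refl a (x : cauchyseq) : cauchy_agree a x x.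
Proof.
move=> r /slt0P r0; exists (step_cst A 0%N) => n _.
apply/dist_ltP => b u v t b0 ba bu bv bt.
by rewrite (part_inj b0 bu bv) subrr normr0; exact: r0 bt.
Qed.
Arguments cauchy_agree_refl a x : clear implicits.

Lemma cauchy_agree_sym a (x y : cauchyseq) :
  cauchy_agree a x y -> cauchy_agree a y x.
Proof.
move=> xy r r0; have [n0 h] := xy _ r0; exists n0 => n n0n.
by apply: dist_sym; exact: h.
Qed.
Arguments cauchy_agree_sym [a x y] _.

Lemma cauchy_agree_trans a (x y z : cauchyseq) :
  cauchy_agree a x y -> cauchy_agree a y z -> cauchy_agree a x z.
Proof.
move=> xy yz r /shalf_gt0 r0; have [n0 h0] := xy _ r0.
have [n1 h1] := yz _ r0; exists (nmax n0 n1) => n hn.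
apply: (@dist_triangle _ _ (y n)).
  by apply: h0; exact: nle_trans (nle_maxl _ _) hn.
by apply: h1; exact: nle_trans (nle_maxr _ _) hn.
Qed.
Arguments cauchy_agree_trans [a x y z] _ _.

Lemma cauchy_agree_le a b (x y : cauchyseq) :
  a <= b -> cauchy_agree b x y -> cauchy_agree a x y.
Proof.
move=> ab xy r r0; have [n0 h] := xy _ r0; exists n0 => n n0n.
by apply: slt_on_le ab _; exact: h.
Qed.
Arguments cauchy_agree_le [a b x y] _ _.

Lemma nle_patch I (p : bpartition A I) (n0 : I -> condnat A) n i :
  nle (concat p n0) n -> exists2 n', nle (n0 i) n' & step_agree (p i) n n'.
Proof.
move=> /nleP h.
pose n' : condnat A :=
  concat (part_bool (p i)) (fun t : bool => if t then n else n0 i).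
have in' b k : \bot < b -> b <= p i ->
    (b <= (n' : step A nat) k) = (b <= (n : step A nat) k).
  by move=> b0 bi; exact: (concat_stepE (a := part_bool (p i))
    (fun t : bool => if t then n else n0 i) (i := true)).
have out' b k : \bot < b -> b <= ~` p i ->
    (b <= (n' : step A nat) k) = (b <= (n0 i : step A nat) k).
  by move=> b0 bi; exact: (concat_stepE (a := part_bool (p i))
    (fun t : bool => if t then n else n0 i) (i := false)).
exists n'; last by apply/step_agreeP => b z b0 bi; rewrite in'.
apply/nleP => b k l b0 bk bl.
have [t [c [c0 cb ct]]] := part_eval (part_bool (p i)) b0.
have {}bk := le_trans cb bk; have {}bl := le_trans cb bl.
case: t ct => ct; last first.
  by rewrite out' // in bl; rewrite (part_inj c0 bk bl).
rewrite in' // in bl; apply: (h c) => //.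
by rewrite (concat_stepE n0 _ c0 ct).
Qed.

Lemma agree_glue_uniq I (p : bpartition A I) (x y : cauchyseq) :
  (forall i, cauchy_agree (p i) x y) -> cauchy_agree \top x y.
Proof.
move=> H r r0; have /choice[n0 h0] i := H i _ r0.
exists (concat p n0) => n hn; apply/dist_ltP => b u v t b0 _ bu bv bt.
have [i [c [c0 cb ci]]] := part_eval p b0.
have [n' n0n' nn'] := nle_patch i hn.
have /dist_ltP := h0 i n' n0n'; apply; first exact: c0; first exact: ci.
- exact: (seq_local nn' c0 ci (le_trans cb bu)).
- exact: (seq_local nn' c0 ci (le_trans cb bv)).
- exact: le_trans cb bt.
Qed.
Arguments agree_glue_uniq [I p x y] _.

Section Glue.
Variables (I : Type) (p : bpartition A I) (x : I -> cauchyseq).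

Let y n : stepreal := concat p (fun i => x i n).

Fact glue_stable : stable y.
Proof.
apply/stableP => m n a /condstepE mn; apply/condstepE/step_agreeP.
move=> b u b0 ba bu; apply: le_dense => c c0 cb.
have [i [d [d0 dc di]]] := part_eval p c0.
have db := le_trans dc cb; exists d; split=> //.
rewrite /y (concat_stepE _ _ d0 di).
apply: (seq_local mn d0 (le_trans db ba)).
by rewrite -(concat_stepE (fun i => x i m) _ d0 di) (le_trans db).
Qed.

Let ys := CondSeq glue_stable.

Fact glue_cauchy : step_cauchy ys.
Proof.
move=> r r0; have /choice[n0 h0] i := cauchyseqP (x i) r0.
exists (concat p n0) => m n hm hn; apply/slt_top/dist_ltP.
move=> b u v t b0 _ bu bv bt.
have [i [c [c0 cb ci]]] := part_eval p b0.
have [m' n0m' mm'] := nle_patch i hm; have [n' n0n' nn'] := nle_patch i hn.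
have {}bu := le_trans cb bu; have {}bv := le_trans cb bv.
rewrite /= /y (concat_stepE _ _ c0 ci) in bu.
rewrite /= /y (concat_stepE _ _ c0 ci) in bv.
have /slt_top/dist_ltP := h0 i m' n' n0m' n0n'; apply; first exact: c0.
- exact: lex1.
- exact: (seq_local mm' c0 ci bu).
- exact: (seq_local nn' c0 ci bv).
- exact: le_trans cb bt.
Qed.

Definition cauchy_glue := CauchySeq glue_cauchy.

Lemma cauchy_glueP i : cauchy_agree (p i) cauchy_glue (x i).
Proof.
move=> r /slt0P r0; exists (step_cst A 0%N) => n _.
apply/dist_ltP => b u v t b0 bi; rewrite /= /y (concat_stepE _ _ b0 bi).
by move=> bu bv bt; rewrite (part_inj b0 bu bv) subrr normr0; exact: r0 bt.
Qed.

End Glue.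
Arguments cauchy_glueP I p x i : clear implicits.

Fact cst_stable (z : stepreal) : stable (fun _ : condnat A => z).
Proof. by apply/stableP. Qed.

Fact cst_cauchy (z : stepreal) : step_cauchy (CondSeq (cst_stable z)).
Proof.
move=> r /slt0P r0; exists (step_cst A 0%N) => m n _ _.
apply/slt_top/dist_ltP => b u v t b0 _ bu bv bt.
by rewrite (part_inj b0 bu bv) subrr normr0; exact: r0 bt.
Qed.

Definition cauchy_cst z := CauchySeq (cst_cauchy z).

Fact add_stable (x y : cauchyseq) :
  stable (fun n : condnat A => sadd (x n) (y n)).
Proof.
apply/stableP => m n a /condstepE mn; apply/condstepE/step_agreeP.
move=> b w b0 ba bw; apply: le_dense => c c0 cb.
have [[u v] [d [d0 dc]]] := step_of_force c0 (le_trans cb bw).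
rewrite /= lexI => /andP[du dv] <-.
have da := le_trans dc (le_trans cb ba); exists d; split=> //.
by apply: step_map2_ge; [exact: seq_local du|exact: seq_local dv].
Qed.

Lemma dist_add a x x' y y' r :
  slt_on a (snorm (ssub x x')) (shalf r) ->
  slt_on a (snorm (ssub y y')) (shalf r) ->
  slt_on a (snorm (ssub (sadd x y) (sadd x' y'))) r.
Proof.
move=> /dist_ltP xx /dist_ltP yy; apply/dist_ltP => b w w' t b0 ba bw bw' bt.
have [[u v] [c [c0 cb]]] := step_of_force b0 bw.
rewrite /= lexI => /andP[cu cv] <-.
have [[u' v'] [d [d0 dc]]] := step_of_force c0 (le_trans cb bw').
rewrite /= lexI => /andP[du' dv'] <-.
have db := le_trans dc cb.
have dt : d <= (shalf r : step A R) (t / 2)%R.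
  by apply: step_map_ge; exact: le_trans db bt.
have h1 := xx _ _ _ _ d0 (le_trans db ba) (le_trans dc cu) du' dt.
have h2 := yy _ _ _ _ d0 (le_trans db ba) (le_trans dc cv) dv' dt.
have := ler_normD (u - u')%R (v - v')%R.
by rewrite (_ : u - u' + (v - v') = u + v - (u' + v'))%R; [lra|ring].
Qed.
Arguments dist_add [a x x' y y' r] _ _.

Fact add_cauchy (x y : cauchyseq) : step_cauchy (CondSeq (add_stable x y)).
Proof.
move=> r /shalf_gt0 r0; have [n0 h0] := cauchyseqP x r0.
have [n1 h1] := cauchyseqP y r0; exists (nmax n0 n1) => m n hm hn.
apply/slt_top/dist_add; apply/slt_top.
  by apply: h0; [move: hm|move: hn]; exact: nle_trans (nle_maxl _ _).
by apply: h1; [move: hm|move: hn]; exact: nle_trans (nle_maxr n0 _).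
Qed.

Definition cauchy_add (x y : cauchyseq) := CauchySeq (add_cauchy x y).

HB.instance Definition _ := gen_eqMixin cauchyseq.
HB.instance Definition _ := gen_choiceMixin cauchyseq.

Definition cauchy_eq : rel cauchyseq :=
  fun x y : cauchyseq => `[< cauchy_agree \top x y >].

Fact cauchy_eq_refl : reflexive cauchy_eq.
Proof. by move=> x; apply/asboolP; exact: cauchy_agree_refl. Qed.

Fact cauchy_eq_sym : symmetric cauchy_eq.
Proof. by move=> x y; apply: asbool_equiv_eq; split; exact: cauchy_agree_sym. Qed.

Fact cauchy_eq_trans : transitive cauchy_eq.
Proof.
by move=> y x z /asboolP xy /asboolP yz; apply/asboolP; exact: cauchy_agree_trans yz.
Qed.

Canonical cauchy_equiv :=
  EquivRel cauchy_eq cauchy_eq_refl cauchy_eq_sym cauchy_eq_trans.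

Definition creal := {eq_quot cauchy_equiv}%qT.

Definition cr_agree a (x y : creal) := cauchy_agree a (repr x) (repr y).

Lemma repr_pi (x : cauchyseq) : cauchy_agree \top (repr (\pi_creal x)%qT) x.
Proof.
have /eqP := reprK (\pi_creal x)%qT.
by rewrite eqmodE => /asboolP.
Qed.
Arguments repr_pi x : clear implicits.

Lemma cr_agree_pi a (x y : cauchyseq) :
  cr_agree a (\pi_creal x)%qT (\pi_creal y)%qT <-> cauchy_agree a x y.
Proof.
have px := cauchy_agree_le (lex1 a) (repr_pi x).
have py := cauchy_agree_le (lex1 a) (repr_pi y).
split=> H.
  exact: cauchy_agree_trans (cauchy_agree_sym px) (cauchy_agree_trans H py).
exact: cauchy_agree_trans px (cauchy_agree_trans H (cauchy_agree_sym py)).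
Qed.

Fact cr_glue (I : Type) (p : bpartition A I) (x : I -> creal) :
  exists! y : creal, forall i, cr_agree (p i) y (x i).
Proof.
exists (\pi_creal (cauchy_glue p (fun i => repr (x i))))%qT; split=> [i|y yx].
  by rewrite -[x i]reprK; apply/cr_agree_pi; exact: cauchy_glueP.
rewrite -[y]reprK; apply/eqP; rewrite eqmodE; apply/asboolP.
apply: (agree_glue_uniq (p := p)) => i.
apply: cauchy_agree_trans (cauchy_glueP _ _ _ i) _.
exact/cauchy_agree_sym/yx.
Qed.

Definition condreal : condset A :=
  @condset_of_agree A creal cr_agree
    (inhabits (\pi_creal (cauchy_cst (scst 0%R)))%qT)
    (fun a (x : creal) => @cauchy_agree_refl a (repr x))
    (fun a (x y : creal) => @cauchy_agree_sym a (repr x) (repr y))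
    (fun a (x y z : creal) => @cauchy_agree_trans a (repr x) (repr y) (repr z))
    (fun a b (x y : creal) => @cauchy_agree_le a b (repr x) (repr y))
    cr_glue.

(* [cr_add_pi], [cr_le_pi] and [cr_lt_pi] below: these definitions do not
   depend on the choice of representatives made by [repr]. *)
Definition cr0 : condreal := (\pi_creal (cauchy_cst (scst 0%R)))%qT.
Definition cr_add (x y : condreal) : condreal :=
  (\pi_creal (cauchy_add (repr (x : creal)) (repr (y : creal))))%qT.
Definition cr_le (x y : condreal) := cauchy_le (repr (x : creal)) (repr (y : creal)).
Definition cr_lt (x y : condreal) := cauchy_lt (repr (x : creal)) (repr (y : creal)).

Lemma cr_add_pi (x y : cauchyseq) :
  cr_add (\pi_creal x)%qT (\pi_creal y)%qT = (\pi_creal (cauchy_add x y))%qT.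
Proof.
apply/eqP; rewrite eqmodE; apply/asboolP => r /shalf_gt0 r0.
have [n0 h0] := repr_pi x _ r0; have [n1 h1] := repr_pi y _ r0.
exists (nmax n0 n1) => n hn; apply: dist_add.
  by apply: h0; exact: nle_trans (nle_maxl _ _) hn.
by apply: h1; exact: nle_trans (nle_maxr n0 _) hn.
Qed.

Definition sthird r : stepreal := step_map (fun u : R => u / 3)%R r.

Lemma sthird_gt0 r : slt (scst 0%R) r -> slt (scst 0%R) (sthird r).
Proof.
move=> /slt0P r0; apply/slt0P => b t b0 bt.
have [u [c [c0 cb cu <-]]] := step_of_force b0 bt.
by have := r0 _ _ c0 cu; lra.
Qed.
Arguments sthird_gt0 [r] _.

Lemma cauchy_le_agree (x y x' y' : cauchyseq) :
  cauchy_agree \top x x' -> cauchy_agree \top y y' ->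
  cauchy_le x y -> cauchy_le x' y'.
Proof.
move=> xx yy xy r /sthird_gt0 r0.
have [n0 h0] := xx _ r0; have [n1 h1] := yy _ r0; have [n2 h2] := xy _ r0.
exists (nmax n0 (nmax n1 n2)) => n hn.
have /h0/dist_ltP {}h0 : nle n0 n by apply: nle_trans (nle_maxl _ _) hn.
have {}hn : nle (nmax n1 n2) n by apply: nle_trans (nle_maxr n0 _) hn.
have /h1/dist_ltP {}h1 : nle n1 n by apply: nle_trans (nle_maxl _ _) hn.
have /h2/sltP {}h2 : nle n2 n by apply: nle_trans (nle_maxr n1 _) hn.
apply/sltP => b s w b0 bs bw.
have [t [c [c0 cb ct <-]]] := step_of_force b0 bs.
have [[v' u0] [d [d0 dc]]] := step_of_force c0 (le_trans cb bw).
rewrite /= lexI => /andP[dv' du0] <-.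
have [u' [e [e0 ed eu' <-]]] := step_of_force d0 du0.
have [u [f [f0 fe fu]]] := part_eval (x n : step A R) e0.
have [v [g [g0 gf gv]]] := part_eval (y n : step A R) f0.
have gu := le_trans gf fu; have ge_ := le_trans gf fe.
have gu' := le_trans ge_ eu'; have gd := le_trans ge_ ed.
have gv' := le_trans gd dv'.
have gt : g <= (sthird r : step A R) (t / 3)%R.
  by apply: step_map_ge; exact: le_trans (le_trans gd dc) ct.
have := h0 _ _ _ _ g0 (lex1 _) gu gu' gt.
have := h1 _ _ _ _ g0 (lex1 _) gv gv' gt.
have := h2 g (- (t / 3))%R (v - u)%R g0 (step_map_ge _ gt)
  (step_map2_ge _ gv (step_map_ge _ gu)).
by rewrite !ltr_norml => ? /andP[? ?] /andP[? ?]; lra.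
Qed.

Lemma cauchy_lt_agree (x y x' y' : cauchyseq) :
  cauchy_agree \top x x' -> cauchy_agree \top y y' ->
  cauchy_lt x y -> cauchy_lt x' y'.
Proof.
move=> xx yy [r r0' [n2 h2]]; have r0 := sthird_gt0 r0'.
have [n0 h0] := xx _ r0; have [n1 h1] := yy _ r0.
exists (sthird r) => //; exists (nmax n0 (nmax n1 n2)) => n hn.
have /h0/dist_ltP {}h0 : nle n0 n by apply: nle_trans (nle_maxl _ _) hn.
have {}hn : nle (nmax n1 n2) n by apply: nle_trans (nle_maxr n0 _) hn.
have /h1/dist_ltP {}h1 : nle n1 n by apply: nle_trans (nle_maxl _ _) hn.
have /h2/sltP {}h2 : nle n2 n by apply: nle_trans (nle_maxr n1 _) hn.
apply/sltP => b s w b0 bs bw.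
have [t [c [c0 cb ct <-]]] := step_of_force b0 bs.
have [[v' u0] [d [d0 dc]]] := step_of_force c0 (le_trans cb bw).
rewrite /= lexI => /andP[dv' du0] <-.
have [u' [e [e0 ed eu' <-]]] := step_of_force d0 du0.
have [u [f [f0 fe fu]]] := part_eval (x n : step A R) e0.
have [v [g [g0 gf gv]]] := part_eval (y n : step A R) f0.
have gu := le_trans gf fu; have ge_ := le_trans gf fe.
have gu' := le_trans ge_ eu'; have gd := le_trans ge_ ed.
have gv' := le_trans gd dv'.
have gtr : g <= (r : step A R) t by exact: le_trans (le_trans gd dc) ct.
have gt : g <= (sthird r : step A R) (t / 3)%R by exact: step_map_ge.
have := h0 _ _ _ _ g0 (lex1 _) gu gu' gt.
have := h1 _ _ _ _ g0 (lex1 _) gv gv' gt.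
have := h2 g t (v - u)%R g0 gtr (step_map2_ge _ gv (step_map_ge _ gu)).
by rewrite !ltr_norml => ? /andP[? ?] /andP[? ?]; lra.
Qed.

Lemma cr_le_pi (x y : cauchyseq) :
  cr_le (\pi_creal x)%qT (\pi_creal y)%qT <-> cauchy_le x y.
Proof.
have [px py] := (repr_pi x, repr_pi y).
by split; apply: cauchy_le_agree => //; exact: cauchy_agree_sym.
Qed.

Lemma cr_lt_pi (x y : cauchyseq) :
  cr_lt (\pi_creal x)%qT (\pi_creal y)%qT <-> cauchy_lt x y.
Proof.
have [px py] := (repr_pi x, repr_pi y).
by split; apply: cauchy_lt_agree => //; exact: cauchy_agree_sym.
Qed.

End ConditionalReals.

(* The values lie in R_+ by [cm_ge0]; concatenation in R_+ is that of R. *)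
Record condmetric (R : realType) (A : cbalg) := CondMetric {
  cm_set :> condset A;
  cm_dist : condprod cm_set cm_set -> condreal R A;
  cm_stable : stable cm_dist;
  cm_ge0 : forall x y, cr_le (cr0 R A) (cm_dist (x, y));
  cm_eq0 : forall x y, cm_dist (x, y) = cr0 R A <-> x = y;
  cm_sym : forall x y, cm_dist (x, y) = cm_dist (y, x);
  cm_triangle : forall x y z,
    cr_le (cm_dist (x, y)) (cr_add (cm_dist (x, z)) (cm_dist (z, y))) }.

Section MetricNotions.
Variables (R : realType) (A : cbalg).
Implicit Types X Y : condmetric R A.

Definition cm_cauchy X (x : condseq X) :=
  forall r, cr_lt (cr0 R A) r -> exists n0, forall m n,
    nle n0 m -> nle n0 n -> cr_lt (cm_dist (x m, x n)) r.

Definition cm_limit X (x : condseq X) (l : X) :=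
  forall r, cr_lt (cr0 R A) r -> exists n0, forall n,
    nle n0 n -> cr_lt (cm_dist (x n, l)) r.

Definition cm_complete X :=
  forall x : condseq X, cm_cauchy x -> exists l, cm_limit x l.

Definition cm_dense X (Y : set X) :=
  forall (x : X) r, cr_lt (cr0 R A) r ->
    exists2 y, Y y & cr_lt (cm_dist (x, y)) r.

Definition cm_isometry X Y (f : X -> Y) :=
  stable f /\ forall x y, cm_dist (f x, f y) = cm_dist (x, y).

Definition cm_isomorphism X Y (f : X -> Y) :=
  cm_isometry f /\ forall y, exists x, f x = y.

Definition cm_isometric X Y := exists f : X -> Y, cm_isomorphism f.

Section Subspace.
Variables (X : condmetric R A) (Y : set X) (sY : stable_subset Y).

Let d (p : condprod (condsub sY) (condsub sY)) : condreal R A :=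
  cm_dist (sval p.1, sval p.2).

Fact subspace_stable : stable d.
Proof.
apply/stableP => -[x y] [x' y'] a [ex ey].
have /stableP := @cm_stable _ _ X; apply.
by rewrite /= /restr /= ; congr pair.
Qed.

Fact subspace_eq0 (x y : condsub sY) : d (x, y) = cr0 R A <-> x = y.
Proof.
rewrite /d cm_eq0 /=; split=> [|-> //].
by case: x y => [x px] [y py] /= ?; exact: eq_exist.
Qed.

Definition cm_subspace : condmetric R A :=
  CondMetric subspace_stable (fun x y => cm_ge0 (sval x) (sval y))
    subspace_eq0 (fun x y => cm_sym (sval x) (sval y))
    (fun x y z => cm_triangle (sval x) (sval y) (sval z)).

End Subspace.

Definition cm_completion X (Xc : condmetric R A) :=
  cm_complete Xc /\
  exists (Y : set Xc) (sY : stable_subset Y),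
    cm_dense Y /\ cm_isometric X (cm_subspace sY).

End MetricNotions.

(* Main.v *)
(* The points of the completion are represented by the distance functions to
   them: stable f : X -> R with f x <= f y + d(x, y), d(x, y) <= f x + f y and
   infimum 0 (Katetov functions).  The distance of f and g is the unique r with
   r <= f x + g x, f x <= g x + r and g x <= f x + r for all x, obtained as the
   limit of g(x_n) with f(x_n) -> 0.  If i : X -> Z is an isometry with dense
   image, then z |-> d(z, i(.)) is a stable isometry of Z into this space, and
   it is onto if Z is complete; Z = X gives the embedding of X, and Z an
   arbitrary completion gives uniqueness.

   Inequalities between conditional reals are reduced to real ones: below every
   non-zero element of A there is a non-zero one over which given conditional
   reals are constant up to an arbitrarily small error. *)
Require Import Defs.
From mathcomp Require Import all_boot all_order all_algebra.
From mathcomp Require Import boolp classical_sets reals.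
From mathcomp Require Import ring lra.

Set Implicit Arguments.
Unset Strict Implicit.
Unset Printing Implicit Defensive.
Import Order.Theory GRing.Theory Num.Theory.
Local Open Scope ring_scope.
Local Open Scope order_scope.

(** * Restrictions, partitions and concatenations in conditional sets *)

Section Restriction.
Variable A : cbalg.
Implicit Types (X Y : condset A) (a b c : A).

Lemma eq_part X I (p : bpartition A I) (x y : X) :
  (forall i, restr x (p i) = restr y (p i)) -> x = y.
Proof.
by move=> xy; rewrite (@concat_uniq _ _ _ p (fun=> y) x xy) concat_cst.
Qed.

Lemma eq_top X (x y : X) : restr x \top = restr y \top -> x = y.
Proof. by move=> xy; apply: (@eq_part _ _ (part_unit A)). Qed.

(** Uniqueness of gluing concerns partitions of [\top]. So [x] is replaced by [y] off [a]; the
    result [z] agrees with [y] on every piece of a refinement of [p], hence equals [y], while it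
    still agrees with [x] on [a]. *)
Lemma restr_part X I (p : bpartition A I) (x y : X) a :
  (forall i, restr x (a `&` p i) = restr y (a `&` p i)) ->
  restr x a = restr y a.
Proof.
move=> xy; pose t (s : bool) := if s then x else y.
pose z := concat (part_bool a) t.
have zx : restr z a = restr x a := concatP (part_bool a) t true.
have zy : restr z (~` a) = restr y (~` a) := concatP (part_bool a) t false.
rewrite -zx; congr restr.
apply: (@eq_part _ _ (part_prod p (fun=> part_bool a))) => -[i []] /=.
  rewrite meetC -xy; apply: restr_le zx; exact: leIl.
by apply: restr_le zy; exact: leIr.
Qed.

Lemma restr_concat X I (p : bpartition A I) (x y : I -> X) a :
  (forall i, restr (x i) a = restr (y i) a) ->
  restr (concat p x) a = restr (concat p y) a.
Proof.
move=> xy; apply: (@restr_part _ _ p) => i.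
rewrite (restr_le (leIr _ _) (concatP p x i)).
rewrite (restr_le (leIr _ _) (concatP p y i)).
exact: restr_le (leIl _ _) (xy i).
Qed.

Lemma concat_pair X Y I (p : bpartition A I) (x : I -> X) (y : I -> Y) :
  concat p (fun i => (x i, y i) : condprod X Y) = (concat p x, concat p y).
Proof.
symmetry; apply: concat_uniq => i.
exact: (f_equal2 pair (concatP p x i) (concatP p y i)).
Qed.

Lemma stable_restr X Y (f : X -> Y) x y a :
  stable f -> restr x a = restr y a -> restr (f x) a = restr (f y) a.
Proof. by move=> /stableP; apply. Qed.

End Restriction.

(** * Conditional natural numbers assembled from local choices *)

Section Mixing.
Variable A : cbalg.
Implicit Types (a b c d : A).

Section Least.
Variable P : A -> nat -> Prop.
Hypothesis P_le : forall d d' k, d' <= d -> P d k -> P d' k.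
Hypothesis P_dense :
  forall b, \bot < b -> exists d k, [/\ \bot < d, d <= b & P d k].

(** Excluding smaller numbers on all non-zero parts of [d], and not just on [d] itself, is what
    makes the suprema for different [k] disjoint. *)
Let T k : set A := [set d | P d k /\ forall j, (j < k)%N ->
  forall c, c <= d -> P c j -> c = \bot]%classic.

Let T_meet k b : \bot < b -> b <= bsup (T k) -> exists d,
  [/\ \bot < d, d <= b & T k d].
Proof.
move=> b0 bT; have [d [Pd Td] p] := lub_meet (bsupP _) b0 bT.
exists (b `&` d); split=> //; first exact: leIl.
split; first by apply: P_le Pd; exact: leIr.
by move=> j jk c cd; apply: Td => //; apply: le_trans cd (leIr _ _).
Qed.

Fact least_disj i j : i <> j -> bsup (T i) `&` bsup (T j) = \bot.
Proof.
wlog ij : i j / (i < j)%N => [hw ne|_].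
  case: (ltngtP i j) => [ij|ji|//]; first exact: hw.
  by rewrite meetC; apply: hw => // e; apply: ne.
apply/eqP; apply: contraT; rewrite -lt0x => p.
have [d [d0 dp [Pd _]]] := T_meet p (leIl _ _).
have [e [e0 ed [_ Te]]] := T_meet d0 (le_trans dp (leIr _ _)).
by rewrite (Te _ ij e (lexx _) (P_le ed Pd)) ltxx in e0.
Qed.

Fact least_cover : isLub (range (fun k => bsup (T k))) \top.
Proof.
apply: lub1 => b b0.
pose Q k := `[< exists d, [/\ \bot < d, d <= b & P d k] >].
have exQ : exists k, Q k.
  by have [d [k ?]] := P_dense b0; exists k; apply/asboolP; exists d.
(* The minimum is taken over all non-zero parts of [b], so no part of [d] admits a smaller number
   and [d] belongs to [T k]. *)
case: (ex_minnP exQ) => k /asboolP[d [d0 db Pd]] kmin.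
exists (bsup (T k)); first by exists k.
apply: lt_le_trans d0 _; rewrite lexI db; apply: bsup_ub; split=> // j jk c cd Pc.
apply/eqP; apply: contraT; rewrite -lt0x => c0.
have /kmin : Q j by apply/asboolP; exists c; split=> //; exact: le_trans cd db.
by rewrite leqNgt jk.
Qed.

(* The part with index k is where k is the least number satisfying P. *)
Lemma mix_nat : exists n : condnat A, forall k b, \bot < b ->
  b <= (n : step A nat) k -> exists d, [/\ \bot < d, d <= b & P d k].
Proof.
exists (Partition least_disj least_cover) => k b b0 /(T_meet b0)[d [d0 db []]].
by exists d.
Qed.

End Least.

Definition ncst k : condnat A := step_cst A k.

Lemma nleE (m n : condnat A) b i j : nle m n -> \bot < b ->
  b <= (m : step A nat) i -> b <= (n : step A nat) j -> (i <= j)%N.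
Proof. by move=> /nleP H; exact: H. Qed.

Lemma step_agree_cst (n : condnat A) d k :
  d <= (n : step A nat) k -> step_agree d (ncst k) n.
Proof.
move=> dn; apply/step_agreeP => b z b0 bd bz.
rewrite -(part_inj b0 (step_cst_ge k b) bz).
exact: le_trans bd dn.
Qed.

(* Over d the number k is represented by an index beyond n0. *)
Lemma local_eventually (n0 : condnat A) b : \bot < b ->
  exists d N, [/\ \bot < d, d <= b & forall k, (N <= k)%N ->
    exists2 n, nle n0 n & d <= (n : step A nat) k].
Proof.
move=> b0; have [N [d [d0 db dN]]] := part_eval (n0 : step A nat) b0.
exists d, N; split=> // k Nk; exists (nmax n0 (ncst k)); first exact: nle_maxl.
by have := step_map2_ge maxn dN (step_cst_ge k d); rewrite (maxn_idPr Nk).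
Qed.

(** The local thresholds [N] are mixed into one [n0]. Over a part where [n0] is [N], any [n] beyond
    [n0] takes only values from [N] on. *)
Lemma mix_eventually (Q : A -> nat -> Prop) :
  (forall d d' k, d' <= d -> Q d k -> Q d' k) ->
  (forall b, \bot < b -> exists d N, [/\ \bot < d, d <= b &
     forall k, (N <= k)%N -> Q d k]) ->
  exists n0 : condnat A, forall n, nle n0 n -> forall b, \bot < b ->
    exists d k, [/\ \bot < d, d <= b, d <= (n : step A nat) k & Q d k].
Proof.
move=> Q_le dQ.
have [n0 h] : exists n : condnat A, forall k b, \bot < b ->
    b <= (n : step A nat) k -> exists d,
    [/\ \bot < d, d <= b & forall j, (k <= j)%N -> Q d j].
  apply: mix_nat => [d d' k dd' H j kj|//]; exact: Q_le dd' (H _ kj).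
exists n0 => n n0n b b0.
have [N [c [c0 cb cN]]] := part_eval (n0 : step A nat) b0.
have [k [d [d0 dc dk]]] := part_eval (n : step A nat) c0.
have [e [e0 ed He]] := h N d d0 (le_trans dc cN).
exists e, k; split=> //; first exact: le_trans ed (le_trans dc cb).
  exact: le_trans ed dk.
by apply: He; exact: nleE n0n d0 (le_trans dc cN) dk.
Qed.

End Mixing.

(** * Real approximations of Cauchy sequences over parts of the algebra *)

Section Near.
Variables (R : realType) (A : cbalg).
Implicit Types (a b c d : A) (s t : cauchyseq R A) (u v w e f g : R).

(* |s - u| <= e on d.  It suffices to look at the constants of N_s, and at
   densely many parts of d. *)
Definition near s d u e := forall f b, (0 < f)%R -> \bot < b -> b <= d ->
  exists c N, [/\ \bot < c, c <= b & forall k, (N <= k)%N ->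
    forall c' w, \bot < c' -> c' <= c ->
    c' <= (s (ncst A k) : step A R) w -> (`|w - u| <= e + f)%R].

Lemma near_sub s d d' u e : d' <= d -> near s d u e -> near s d' u e.
Proof. by move=> dd' H f b f0 b0 bd'; apply: H => //; exact: le_trans dd'. Qed.

Lemma near_pair s t d u v e f g b :
  (0 < g)%R -> \bot < b -> b <= d -> near s d u e -> near t d v f ->
  exists c N, [/\ \bot < c, c <= b & forall k, (N <= k)%N ->
    forall c' w w', \bot < c' -> c' <= c ->
    c' <= (s (ncst A k) : step A R) w -> c' <= (t (ncst A k) : step A R) w' ->
    (`|w - u| <= e + g)%R /\ (`|w' - v| <= f + g)%R].
Proof.
move=> g0 b0 bd Hs Ht; have [c [N [c0 cb cN]]] := Hs _ _ g0 b0 bd.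
have [c1 [N1 [c10 c1c cN1]]] := Ht _ _ g0 c0 (le_trans cb bd).
exists c1, (maxn N N1); split=> //; first exact: le_trans c1c cb.
move=> k; rewrite geq_max => /andP[Nk N1k] c' w w' c'0 c'c sw tw.
split; last exact: cN1 sw' || exact: cN1 tw.
by apply: (cN k Nk c') => //; exact: le_trans c'c c1c.
Qed.

(** One comparison at a late index, over some part, is enough to compare [u] and [v]. Each of the
    two approximations costs an extra [g], and the comparison itself the third. *)
Lemma near_meet s t d u v e f g :
  (0 < g)%R -> \bot < d -> near s d u e -> near t d v f ->
  (forall N c, \bot < c -> c <= d -> exists c' k w w',
    [/\ (N <= k)%N, \bot < c', c' <= c, c' <= (s (ncst A k) : step A R) w &
     c' <= (t (ncst A k) : step A R) w' /\ (w <= w' + g)%R]) ->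
  (u <= v + e + f + 3 * g)%R.
Proof.
move=> g0 d0 Hs Ht H.
have [c [N [c0 cd cN]]] := near_pair g0 d0 (lexx _) Hs Ht.
have [c' [k [w [w' [Nk c'0 c'c sw [tw ww']]]]]] := H N c c0 cd.
have := cN k Nk c' w w' c'0 c'c sw tw.
by rewrite !ler_norml => -[] /andP[? ?] /andP[? ?]; lra.
Qed.

(** Passage from conditional indices to constants: from [N] on, [ncst A k] agrees over [c] with some
    index beyond [n0], and stability ([seq_local]) carries the estimate over. *)
Lemma agree_local s t a g b : cauchy_agree a s t ->
  (0 < g)%R -> \bot < b -> b <= a ->
  exists c N, [/\ \bot < c, c <= b & forall k, (N <= k)%N ->
    forall c' w w', \bot < c' -> c' <= c ->
    c' <= (s (ncst A k) : step A R) w -> c' <= (t (ncst A k) : step A R) w' ->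
    (`|w - w'| < g)%R].
Proof.
move=> st g0 b0 ba.
have r0 : slt (scst A (0 : R)%R) (scst A g).
  by apply/slt0P => x y x0 /(part_inj x0 (step_cst_ge g x)) <-.
have [n0 h0] := st _ r0.
have [c [N [c0 cb cN]]] := local_eventually n0 b0.
exists c, N; split=> // k Nk c' w w' c'0 c'c sw tw.
have [n n0n cn] := cN k Nk; have kn := step_agree_cst (le_trans c'c cn).
have /dist_ltP h := h0 n n0n.
apply: (h c') => //; first exact: le_trans c'c (le_trans cb ba).
- exact: seq_local kn c'0 (lexx _) sw.
- exact: seq_local kn c'0 (lexx _) tw.
exact: step_cst_ge.
Qed.

Lemma near_agree s t a d u e : cauchy_agree a s t -> d <= a ->
  near s d u e -> near t d u e.
Proof.
move=> st da H g b g0 b0 bd; have g2 : (0 < g / 2)%R by lra.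
have [c [N [c0 cb cN]]] := H _ _ g2 b0 bd.
have [c1 [N1 [c10 c1c cN1]]] :=
  agree_local st g2 c0 (le_trans cb (le_trans bd da)).
exists c1, (maxn N N1); split=> //; first exact: le_trans c1c cb.
move=> k; rewrite geq_max => /andP[Nk N1k] c' w' c'0 c'c tw.
have [w [c2 [c20 c2c' sw]]] := part_eval (s (ncst A k) : step A R) c'0.
have c2c1 := le_trans c2c' c'c.
have := cN k Nk c2 w c20 (le_trans c2c1 c1c) sw.
have := cN1 k N1k c2 w w' c20 c2c1 sw (le_trans c2c' tw).
by rewrite !ler_norml !ltr_norml => /andP[? ?] /andP[? ?]; lra.
Qed.

(** A term of [s] at a Cauchy index for [e] serves as [q]. A single step function covers all parts
    at once, which the construction of limits in [cr_limit] relies on. *)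
Lemma near_approx s e : (0 < e)%R -> exists q : stepreal R A,
  forall d w, d <= (q : step A R) w -> near s d w e.
Proof.
move=> e0.
have r0 : slt (scst A (0 : R)%R) (scst A e).
  by apply/slt0P => x y x0 /(part_inj x0 (step_cst_ge e x)) <-.
have [n0 h0] := cauchyseqP s r0; exists (s n0) => d w dw g b g0 b0 bd.
have [c [N [c0 cb cN]]] := local_eventually n0 b0.
exists c, N; split=> // k Nk c' v c'0 c'c sv.
have [n n0n cn] := cN k Nk; have kn := step_agree_cst (le_trans c'c cn).
have /slt_top/dist_ltP h := h0 n n0 n0n (@nle_refl _ n0).
have c'w := le_trans (le_trans c'c (le_trans cb bd)) dw.
have := h c' v w e c'0 (lex1 _) (seq_local kn c'0 (lexx _) sv) c'w
  (step_cst_ge e c').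
lra.
Qed.

Lemma near_locate s e b : (0 < e)%R -> \bot < b ->
  exists d u, [/\ \bot < d, d <= b & near s d u e].
Proof.
move=> e0 b0; have [q hq] := near_approx s e0.
have [u [d [d0 db dq]]] := part_eval (q : step A R) b0.
by exists d, u; split=> //; exact: hq.
Qed.

Lemma near_cauchy_add s t d u v e f :
  near s d u e -> near t d v f -> near (cauchy_add s t) d (u + v)%R (e + f)%R.
Proof.
move=> Hs Ht g b g0 b0 bd; have g2 : (0 < g / 2)%R by lra.
have [c [N [c0 cb cN]]] := near_pair g2 b0 bd Hs Ht.
exists c, N; split=> // k Nk c' z c'0 c'c /(step_of_force c'0).
move=> [[w w'] [c1 [c10 c1c' /=]]]; rewrite lexI => /andP[sw tw] <-.
have := cN k Nk c1 w w' c10 (le_trans c1c' c'c) sw tw.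
by rewrite !ler_norml => -[] /andP[? ?] /andP[? ?]; lra.
Qed.

Lemma near_cauchy_cst d u : near (cauchy_cst (scst A u)) d u 0%R.
Proof.
move=> g b g0 b0 bd; exists b, 0%N; split=> // k _ c w c0 cb cw.
by rewrite (part_inj c0 cw (step_cst_ge u c)) subrr normr0; lra.
Qed.

(** The estimates between approximate values bound the terms at constant indices on densely many
    parts; [mix_eventually] turns this into a bound at all late conditional indices. *)
Lemma cauchy_agreeI s t a :
  (forall d u v e f, \bot < d -> d <= a -> near s d u e -> near t d v f ->
    (`|u - v| <= e + f)%R) -> cauchy_agree a s t.
Proof.
move=> H r /slt0P r0.
pose Q d k := forall c w w' x, \bot < c -> c <= d -> c <= a ->
  c <= (s (ncst A k) : step A R) w -> c <= (t (ncst A k) : step A R) w' ->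
  c <= (r : step A R) x -> (`|w - w'| < x)%R.
have [d d' k dd' Qd|b b0|n0 h0] := @mix_eventually A Q.
- by move=> c w w' x c0 cd'; apply: Qd => //; exact: le_trans dd'.
(* Where [b] misses [a], [Q] holds vacuously; otherwise a part is sought below the meet. *)
- have [ba|ba] := eqVneq (b `&` a) \bot.
    exists b, 0%N; split=> // k _ c w w' x c0 cb ca.
    have : c <= b `&` a by rewrite lexI cb.
    by rewrite ba lex0 => /eqP c0'; rewrite c0' ltxx in c0.
  have {}b0 : \bot < b `&` a by rewrite lt0x.
  have [x [c [c0 cb cx]]] := part_eval (r : step A R) b0.
  (* The terms are within two ninths of [u] and of [v], which differ by at most two ninths: six
     ninths in all, strictly below [x]. *)
  have x0 := r0 _ _ c0 cx; have x9 : (0 < x / 9)%R by lra.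
  have [d [u [d0 dc su]]] := near_locate s x9 c0.
  have [d1 [v [d10 d1d tv]]] := near_locate t x9 d0.
  have da : d1 <= a.
    exact: le_trans d1d (le_trans dc (le_trans cb (leIr _ _))).
  have uv := H _ _ _ _ _ d10 da (near_sub d1d su) tv.
  have [d2 [N [d20 d2d1 d2N]]] :=
    near_pair x9 d10 (lexx _) (near_sub d1d su) tv.
  have d2c : d2 <= c := le_trans d2d1 (le_trans d1d dc).
  exists d2, N; split=> //; first exact: le_trans d2c (le_trans cb (leIl _ _)).
  move=> k Nk c' w w' y c'0 c'd2 c'a sw tw ry.
  rewrite (part_inj c'0 ry (le_trans c'd2 (le_trans d2c cx))).
  have := d2N k Nk c' w w' c'0 c'd2 sw tw.
  move: uv; rewrite !ler_norml ltr_norml => /andP[? ?] -[] /andP[? ?] /andP[? ?].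
  lra.
exists n0 => n n0n; apply/dist_ltP => b w w' x b0 ba sw tw rx.
have [d [k [d0 db dn Qdk]]] := h0 n n0n b b0.
have kn : step_agree d n (ncst A k).
  by move=> z; rewrite (step_agree_cst dn).
apply: (Qdk d) => //; first exact: le_trans db ba.
- exact: seq_local kn d0 (lexx _) (le_trans db sw).
- exact: seq_local kn d0 (lexx _) (le_trans db tw).
exact: le_trans db rx.
Qed.

Lemma cauchy_le_near s t d u v e f : cauchy_le s t ->
  \bot < d -> near s d u e -> near t d v f -> (u <= v + e + f)%R.
Proof.
move=> st d0 Hs Ht; case: (lerP u (v + e + f)%R) => // lt.
(* [near_meet] loses [3 * g], so a quarter of the supposed gap gives a contradiction. *)
pose g := ((u - (v + e + f)) / 4)%R; have g0 : (0 < g)%R by rewrite /g; lra.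
suff : (u <= v + e + f + 3 * g)%R by rewrite /g; lra.
apply: (near_meet g0 d0 Hs Ht) => N c c0 cd.
have r0 : slt (scst A (0 : R)%R) (scst A g).
  by apply/slt0P => x y x0 /(part_inj x0 (step_cst_ge g x)) <-.
have [n0 h0] := st _ r0.
have [c1 [N1 [c10 c1c cN]]] := local_eventually n0 c0.
have [n n0n cn] := cN _ (leq_maxr N N1).
pose k := maxn N N1; have kn := step_agree_cst cn.
have [w [c2 [c20 c2c1 sw]]] := part_eval (s (ncst A k) : step A R) c10.
have [w' [c3 [c30 c3c2 tw]]] := part_eval (t (ncst A k) : step A R) c20.
have {}sw := le_trans c3c2 sw; have c3c1 := le_trans c3c2 c2c1.
exists c3, k, w, w'; split=> //.
- exact: leq_maxl.
- exact: le_trans c3c1 c1c.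
split=> //.
have /sltP h := h0 n n0n.
have := h c3 (- g)%R (w' - w)%R c30.
rewrite step_map_ge ?step_cst_ge // => /(_ isT); rewrite step_map2_ge.
- by move=> /(_ isT); lra.
- exact: seq_local kn c30 c3c1 tw.
by apply: step_map_ge; exact: seq_local kn c30 c3c1 sw.
Qed.

(** The mixing argument of [cauchy_agreeI] with one-sided estimates, again with six ninths of the
    tolerance used up. *)
Lemma cauchy_leI s t :
  (forall d u v e f, \bot < d -> near s d u e -> near t d v f ->
    (u <= v + e + f)%R) -> cauchy_le s t.
Proof.
move=> H r /slt0P r0.
pose Q d k := forall c w w' x, \bot < c -> c <= d ->
  c <= (s (ncst A k) : step A R) w -> c <= (t (ncst A k) : step A R) w' ->
  c <= (r : step A R) x -> (w < w' + x)%R.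
have [d d' k dd' Qd|b b0|n0 h0] := @mix_eventually A Q.
- by move=> c w w' x c0 cd'; apply: Qd => //; exact: le_trans dd'.
- have [x [c [c0 cb cx]]] := part_eval (r : step A R) b0.
  have x0 := r0 _ _ c0 cx; have x9 : (0 < x / 9)%R by lra.
  have [d [u [d0 dc su]]] := near_locate s x9 c0.
  have [d1 [v [d10 d1d tv]]] := near_locate t x9 d0.
  have uv := H _ _ _ _ _ d10 (near_sub d1d su) tv.
  have [d2 [N [d20 d2d1 d2N]]] :=
    near_pair x9 d10 (lexx _) (near_sub d1d su) tv.
  have d2c : d2 <= c := le_trans d2d1 (le_trans d1d dc).
  exists d2, N; split=> //; first exact: le_trans d2c cb.
  move=> k Nk c' w w' y c'0 c'd2 sw tw ry.
  rewrite (part_inj c'0 ry (le_trans c'd2 (le_trans d2c cx))).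
  have := d2N k Nk c' w w' c'0 c'd2 sw tw.
  move: uv; rewrite !ler_norml => ? -[] /andP[? ?] /andP[? ?].
  lra.
exists n0 => n n0n; apply/sltP => b p q b0 bp bq.
have [x [c1 [c10 c1b rx <-]]] := step_of_force b0 bp.
have [[w' z] [c2 [c20 c2c1]]] := step_of_force c10 (le_trans c1b bq).
rewrite /= lexI => /andP[tw c2z] <-.
have [w [c3 [c30 c3c2 sw <-]]] := step_of_force c20 c2z.
have [d [k [d0 db dn Qdk]]] := h0 n n0n c3 c30.
have kn : step_agree d n (ncst A k).
  by move=> y; rewrite (step_agree_cst dn).
have dc2 := le_trans db c3c2.
have := Qdk d w w' x d0 (lexx _)
  (seq_local kn d0 (lexx _) (le_trans db sw))
  (seq_local kn d0 (lexx _) (le_trans dc2 tw))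
  (le_trans (le_trans dc2 c2c1) rx).
lra.
Qed.

Definition invn (k : nat) : R := k.+1%:R^-1%R.

Lemma invn_small e : (0 < e)%R -> exists k : nat, (invn k < e)%R.
Proof. by move=> /ltr_add_invr[k]; rewrite add0r => ?; exists k. Qed.

Lemma invn_gt0 k : (0 < invn k)%R.
Proof. by rewrite invr_gt0 ltr0n. Qed.

Lemma invn_le k j : (k <= j)%N -> (invn j <= invn k)%R.
Proof. by move=> kj; rewrite /invn lef_pV2 ?posrE ?ltr0n // ler_nat. Qed.

(** The gaps over the various parts may have no common positive real lower bound, but [cauchy_lt]
    allows a step function. One mixed number [n0] records both the gap and the threshold index, and
    [step_map invn n0] is the positive lower bound. *)
Lemma cauchy_ltI s t :
  (forall b, \bot < b -> exists d u v e f,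
    [/\ \bot < d, d <= b, near s d u e, near t d v f & (u + e < v - f)%R]) ->
  cauchy_lt s t.
Proof.
move=> H.
pose P d N := forall k, (N <= k)%N -> forall c w w', \bot < c -> c <= d ->
  c <= (s (ncst A k) : step A R) w -> c <= (t (ncst A k) : step A R) w' ->
  (invn N < w' - w)%R.
have [d d' k dd' Pd|b b0|n0 h0] := @mix_nat A P.
- by move=> j kj c w w' c0 cd'; apply: Pd => //; exact: le_trans dd'.
- have [d [u [v [e [f [d0 db su tv uv]]]]]] := H b b0.
  pose g := ((v - f - (u + e)) / 4)%R; have g0 : (0 < g)%R by rewrite /g; lra.
  have [c [N [c0 cd cN]]] := near_pair g0 d0 (lexx _) su tv.
  have [M Mg] := invn_small g0.
  (* [M] brings [invn] below [g] and [N] is the index from which the approximations hold; the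
     maximum serves both purposes. *)
  exists c, (maxn M N); split=> //; first exact: le_trans cd db.
  move=> k; rewrite geq_max => /andP[_ Nk] c' w w' c'0 c'c sw tw.
  apply: le_lt_trans (invn_le (leq_maxl M N)) (lt_trans Mg _).
  have := cN k Nk c' w w' c'0 c'c sw tw.
  by rewrite /g !ler_norml => -[] /andP[? ?] /andP[? ?]; lra.
exists (step_map invn n0).
  apply/slt0P => b x b0 bx; have [k [c [_ _ _ <-]]] := step_of_force b0 bx.
  exact: invn_gt0.
exists n0 => n n0n; apply/sltP => b p q b0 bp bq.
have [N [c [c0 cb cN <-]]] := step_of_force b0 bp.
have [[w' z] [c1 [c10 c1c]]] := step_of_force c0 (le_trans cb bq).
rewrite /= lexI => /andP[tw c1z] <-.
have [w [c2 [c20 c2c1 sw <-]]] := step_of_force c10 c1z.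
have [k [c3 [c30 c3c2 c3k]]] := part_eval (n : step A nat) c20.
have c3N : c3 <= (n0 : step A nat) N.
  exact: le_trans c3c2 (le_trans c2c1 (le_trans c1c cN)).
have [d [d0 db Pd]] := h0 N c3 c30 c3N.
have Nk := nleE n0n c30 c3N c3k.
have kn : step_agree d n (ncst A k).
  by move=> y; rewrite (step_agree_cst (le_trans db c3k)).
have dc2 := le_trans db c3c2.
apply: (Pd k Nk d) => //.
  exact: seq_local kn d0 (lexx _) (le_trans dc2 sw).
exact: seq_local kn d0 (lexx _) (le_trans (le_trans dc2 c2c1) tw).
Qed.

(** Over a part where the witness [r] of positivity is a constant [x], late terms of [s] exceed [x],
    so no approximating interval can end below it; [invn k] is chosen smaller than [x]. *)
Lemma cauchy_gt0_local s b : cauchy_lt (cauchy_cst (scst A 0%R)) s ->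
  \bot < b -> exists d k, [/\ \bot < d, d <= b & forall c u e,
    \bot < c -> c <= d -> near s c u e -> (invn k <= u + e)%R].
Proof.
move=> [r r0 [n0 h0]] b0.
have [x [c [c0 cb cx]]] := part_eval (r : step A R) b0.
have x0 : (0 < x)%R by move/slt0P: r0 => /(_ c x c0 cx).
have [k kx] := invn_small x0.
exists c, k; split=> // d u e d0 dc su.
case: (lerP x (u + e)%R) => [|ux]; first exact/le_trans/ltW.
pose g := ((x - (u + e)) / 2)%R; have g0 : (0 < g)%R by rewrite /g; lra.
have [d1 [N [d10 d1d dN]]] := su _ _ g0 d0 (lexx _).
have [d2 [N1 [d20 d2d1 d2N]]] := local_eventually n0 d10.
pose j := maxn N N1; have [n n0n jn] := d2N j (leq_maxr _ _).
have kn := step_agree_cst jn.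
have [w [d3 [d30 d3d2 sw]]] := part_eval (s (ncst A j) : step A R) d20.
have /sltP h := h0 n n0n.
have d3c := le_trans d3d2 (le_trans d2d1 (le_trans d1d dc)).
have := h d3 x (w - 0)%R d30 (le_trans d3c cx).
rewrite step_map2_ge => [/(_ isT)||].
- have := dN j (leq_maxl _ _) d3 w d30 (le_trans d3d2 d2d1) sw.
  by rewrite ler_norml /g => /andP[? ?] ?; lra.
- exact: seq_local kn d30 d3d2 sw.
by rewrite -oppr0; apply: step_map_ge; exact: step_cst_ge.
Qed.

(** A conditional natural number is a partition indexed by [nat], so an ordinary sequence extends to
    conditional indices by concatenating its terms along that partition. *)
Lemma cauchy_of_nat (q : nat -> stepreal R A) :
  (forall e, (0 < e)%R -> exists N, forall j k, (N <= j)%N -> (N <= k)%N ->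
    forall c w w', \bot < c -> c <= (q j : step A R) w ->
      c <= (q k : step A R) w' -> (`|w - w'| <= e)%R) ->
  exists s : cauchyseq R A, forall k, s (ncst A k) = q k.
Proof.
move=> H; pose y (n : condnat A) : stepreal R A := concat (n : step A nat) q.
have y_at n c k u : \bot < c -> c <= (n : step A nat) k ->
    (c <= (y n : step A R) u) = (c <= (q k : step A R) u).
  by move=> c0 cn; rewrite /y (concat_stepE q _ c0 cn).
have sy : stable y.
  apply/stableP => m n a /condstepE/step_agreeP mn.
  apply/condstepE/step_agreeP => b u b0 ba bu.
  apply: le_dense => c c0 cb.
  have [k [d [d0 dc dk]]] := part_eval (m : step A nat) c0.
  have db := le_trans dc cb.
  exists d; split=> //; rewrite (y_at _ _ k) //; last exact: mn (le_trans db ba) dk.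
  by rewrite -(y_at m) // (le_trans db).
have cy : step_cauchy (CondSeq sy).
  move=> r /slt0P r0.
  (* The tolerance [r] varies from part to part; the thresholds that [H] gives for its real values
     are mixed into one index. *)
  have [d d' k dd' Pd|b b0|n0 h0] := @mix_nat A (fun d N => forall x c,
      \bot < c -> c <= d -> c <= (r : step A R) x -> forall i j, (N <= i)%N ->
      (N <= j)%N -> forall c w w', \bot < c -> c <= (q i : step A R) w ->
      c <= (q j : step A R) w' -> (`|w - w'| < x)%R).
  - by move=> x c c0 cd'; apply: Pd => //; exact: le_trans dd'.
  - have [x [c [c0 cb cx]]] := part_eval (r : step A R) b0.
    have x0 := r0 _ _ c0 cx.
    have x2 : (0 < x / 2)%R by lra.
    have [N hN] := H _ x2.
    exists c, N; split=> // x' c1 c10 c1c rx i j Ni Nj c2 w w' c20 qw qw'.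
    rewrite (part_inj c10 rx (le_trans c1c cx)).
    by have := hN i j Ni Nj c2 w w' c20 qw qw'; lra.
  exists n0 => m n n0m n0n; apply/slt_top/dist_ltP => b u v x b0 _ mu nv rx.
  have [N [c [c0 cb cN]]] := part_eval (n0 : step A nat) b0.
  have [i [c1 [c10 c1c c1i]]] := part_eval (m : step A nat) c0.
  have [j [c2 [c20 c2c1 c2j]]] := part_eval (n : step A nat) c10.
  have c2c := le_trans c2c1 c1c; have c2b := le_trans c2c cb.
  have [d [d0 dc2 Pd]] := h0 N c2 c20 (le_trans c2c cN).
  apply: (Pd x d d0 (lexx _) (le_trans dc2 (le_trans c2b rx)) i j _ _ c2) => //.
  - exact: nleE n0m c10 (le_trans c1c cN) c1i.
  - exact: nleE n0n c20 (le_trans c2c cN) c2j.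
  - by rewrite -(y_at m c2 i u c20 (le_trans c2c1 c1i)); exact: le_trans mu.
  by rewrite -(y_at n c2 j v c20 c2j); exact: le_trans nv.
exists (CauchySeq cy) => k; apply: step_ext => b z b0 bz.
exists b; split=> //; rewrite -(y_at (ncst A k)) //; exact: step_cst_ge.
Qed.

End Near.

(** * Transfer of inequalities between conditional and real numbers *)

Section CondRealOrder.
Variables (R : realType) (A : cbalg).
Implicit Types (a b c d : A) (x y z : condreal R A) (u v w e f g : R).

Definition cr_near x d u e := near (repr (x : creal R A)) d u e.
Definition cr_cst u : condreal R A := (\pi_(creal R A) (cauchy_cst (scst A u)))%qT.

Lemma cr_near_sub x d d' u e : d' <= d -> cr_near x d u e -> cr_near x d' u e.
Proof. exact: near_sub. Qed.

Lemma cr_near_pi (s : cauchyseq R A) d u e :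
  near s d u e -> cr_near (\pi_(creal R A) s)%qT d u e.
Proof. exact/near_agree/lex1/cauchy_agree_sym/repr_pi. Qed.

Lemma cr_near_cst u d : cr_near (cr_cst u) d u 0%R.
Proof. exact/cr_near_pi/near_cauchy_cst. Qed.

Lemma cr_near_add x y d u v e f : cr_near x d u e -> cr_near y d v f ->
  cr_near (cr_add x y) d (u + v)%R (e + f)%R.
Proof. by move=> xu yv; apply/cr_near_pi/near_cauchy_add. Qed.

Lemma cr_near_restr x y a d u e : restr x a = restr y a -> d <= a ->
  cr_near x d u e -> cr_near y d u e.
Proof. by move=> /condset_of_agreeE xy; exact: near_agree. Qed.

Lemma cr_near_concat I (p : bpartition A I) (x : I -> condreal R A) i d u e :
  d <= p i -> cr_near (x i) d u e -> cr_near (concat p x) d u e.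
Proof. exact/cr_near_restr/esym/concatP. Qed.

Lemma cr_restrI x y a :
  (forall d u v e f, \bot < d -> d <= a -> cr_near x d u e ->
     cr_near y d v f -> (`|u - v| <= e + f)%R) -> restr x a = restr y a.
Proof. by move=> H; apply/condset_of_agreeE/cauchy_agreeI. Qed.

Lemma cr_locate x e b : (0 < e)%R -> \bot < b ->
  exists d u, [/\ \bot < d, d <= b & cr_near x d u e].
Proof. exact: near_locate. Qed.

(** A late term of the representing sequence is close to both [u] and [v] over a common part. *)
Lemma cr_near_uniq x d u v e f : \bot < d -> cr_near x d u e ->
  cr_near x d v f -> (`|u - v| <= e + f)%R.
Proof.
move=> d0 xu xv; case: (lerP `|u - v|%R (e + f)%R) => // lt.
pose g := ((`|u - v| - (e + f)) / 4)%R; have g0 : (0 < g)%R by rewrite /g; lra.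
have [c [N [c0 cd cN]]] := near_pair g0 d0 (lexx _) xu xv.
have [w [c1 [c10 c1c xw]]] :=
  part_eval (repr (x : creal R A) (ncst A N) : step A R) c0.
have [uw vw] := cN N (leqnn N) c1 w w c10 c1c xw xw.
have := ler_distD w u v; rewrite distrC in uw.
by move: g0 uw vw; rewrite /g; lra.
Qed.

Lemma cr_le_near x y d u v e f : cr_le x y -> \bot < d ->
  cr_near x d u e -> cr_near y d v f -> (u <= v + e + f)%R.
Proof. exact: cauchy_le_near. Qed.

Lemma cr_leI x y :
  (forall d u v e f, \bot < d -> cr_near x d u e -> cr_near y d v f ->
    (u <= v + e + f)%R) -> cr_le x y.
Proof. exact: cauchy_leI. Qed.

(** The values come from one function [v], so that all occurrences of an atom are replaced by the
    same real number before [lra] is called. *)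
Fixpoint cr_near_all d e (v : condreal R A -> R) (xs : seq (condreal R A)) :=
  if xs is x :: xs' then cr_near x d (v x) e /\ cr_near_all d e v xs' else True.

Lemma cr_locate_all xs e b : (0 < e)%R -> \bot < b ->
  exists d (v : condreal R A -> R), [/\ \bot < d, d <= b & cr_near_all d e v xs].
Proof.
move=> e0 b0; elim: xs => [|x xs [d [v [d0 db vxs]]]].
  by exists b, (fun=> 0%R).
have [c [u [c0 cd xu]]] := cr_locate x e0 d0.
exists c, (fun y => if pselect (y = x) then u else v y).
split=> //; first exact: le_trans cd db.
split; first by case: pselect.
(* An entry of [xs] that equals [x] now receives the value [u], which approximates it as well. *)
elim: xs vxs => //= y xs IH [yv /IH xsv]; split=> //.
by case: pselect => [yx|_] /=; [rewrite yx|exact: cr_near_sub yv].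
Qed.

(** As [e] is arbitrary, an error of [100 * e] does no harm; the factor is a generous allowance for
    the approximation errors of the atoms. Subtracting [f] and [g] pays for comparing these
    approximations with others through [cr_near_uniq]. *)
Lemma cr_le_transfer (xs : seq (condreal R A)) x y :
  (forall d e (v : condreal R A -> R), \bot < d -> (0 < e)%R ->
    cr_near_all d e v xs ->
    exists u f w g, [/\ cr_near x d u f, cr_near y d w g &
      (u <= w + 100 * e - f - g)%R]) -> cr_le x y.
Proof.
move=> H; apply: cr_leI => d u w f g d0 xu yw.
case: (lerP u (w + f + g)%R) => // lt.
pose e := ((u - (w + f + g)) / 200)%R; have e0 : (0 < e)%R by rewrite /e; lra.
have [c [v [c0 cd vxs]]] := cr_locate_all xs e0 d0.
have [u' [f' [w' [g' [xu' yw' le']]]]] := H c e v c0 e0 vxs.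
have := cr_near_uniq c0 (cr_near_sub cd xu) xu'.
have := cr_near_uniq c0 (cr_near_sub cd yw) yw'.
move: lt le'; rewrite /e !ler_norml; clear => ? ? /andP[? ?] /andP[? ?]; lra.
Qed.

End CondRealOrder.

Arguments cr_near_cst {R A} u d.

Ltac cr_near_auto :=
  solve [repeat first [eassumption | apply: cr_near_cst | apply: cr_near_add]].

(* The inequalities of the context are combined linearly; xs lists the atoms. *)
Ltac cr_lra xs :=
  let d0 := fresh in let e0 := fresh in let nr := fresh in
  apply: (@cr_le_transfer _ _ xs) => ? ? ? d0 e0 /= nr;
  repeat match goal with H : _ /\ _ |- _ => destruct H end;
  repeat match goal with H : cr_le _ _ |- _ =>
    first [move: (cr_le_near H d0 ltac:(cr_near_auto) ltac:(cr_near_auto))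
          | idtac]; clear H end;
  intros; do 4 eexists; split; [cr_near_auto | cr_near_auto | lra].

(** * Order, addition and limits of conditional reals *)

Section CondRealTheory.
Variables (R : realType) (A : cbalg).
Implicit Types (a b c d : A) (x y z : condreal R A) (u v w e f g : R).
Local Notation cst := (cr_cst A).
Local Notation "x +! y" := (cr_add x y) (at level 50, left associativity).

Lemma cr_le_trans y x z : cr_le x y -> cr_le y z -> cr_le x z.
Proof. by move=> xy yz; cr_lra [:: x; y; z]. Qed.

Lemma cr_le_anti x y : cr_le x y -> cr_le y x -> x = y.
Proof.
move=> xy yx; apply/eq_top/cr_restrI => d u v e f d0 _ xu yv.
have := cr_le_near xy d0 xu yv; have := cr_le_near yx d0 yv xu.
by rewrite ler_norml => ? ?; apply/andP; split; lra.
Qed.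

Lemma cr_le_arch x y :
  (forall e, (0 < e)%R -> cr_le x (y +! cst e)) -> cr_le x y.
Proof.
move=> H; apply: (cr_le_transfer (xs := [:: x; y])) => d e v d0 e0 [xv [yv _]].
have := cr_le_near (H _ e0) d0 xv (cr_near_add yv (cr_near_cst e d)).
by move=> ?; exists (v x), e, (v y), e; split=> //; lra.
Qed.

(** Every non-zero part meets some [p i], over which the two concatenations are [x i] and [y i]. *)
Lemma cr_le_concat I (p : bpartition A I) (x y : I -> condreal R A) :
  (forall i, cr_le (x i) (y i)) -> cr_le (concat p x) (concat p y).
Proof.
move=> xy; apply: cr_leI => d u v e f d0 xu yv.
have [i [c [c0 cd ci]]] := part_eval p d0.
apply: (cr_le_near (xy i) c0).
  by apply: cr_near_restr (concatP p x i) ci (cr_near_sub cd xu).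
by apply: cr_near_restr (concatP p y i) ci (cr_near_sub cd yv).
Qed.

Lemma cr_add_concat I (p : bpartition A I) (x y : I -> condreal R A) :
  concat p x +! concat p y = concat p (fun i => x i +! y i).
Proof.
apply: concat_uniq => i; apply: cr_restrI => d u v e f d0 di xu yv.
apply/ler_addgt0Pr => h h0; pose g := (h / 4)%R.
have gp : (0 < g)%R by rewrite /g; lra.
have [c [w [c0 cd [xw [yw _]]]]] := cr_locate_all [:: x i; y i] gp d0.
have ci := le_trans cd di.
have h1 := cr_near_uniq c0 (cr_near_sub cd xu)
  (cr_near_add (cr_near_concat ci xw) (cr_near_concat ci yw)).
have h2 := cr_near_uniq c0 (cr_near_sub cd yv) (cr_near_add xw yw).
rewrite distrC in h2.
have := ler_distD (w (x i) + w (y i))%R u v.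
by move: h1 h2; rewrite /g; clear; lra.
Qed.

Lemma cr_cst_gt0 e : (0 < e)%R -> cr_lt (cr0 R A) (cst e).
Proof.
move=> e0; apply: cauchy_ltI => b b0; exists b, 0%R, e, 0%R, 0%R.
by split=> //; [exact: cr_near_cst|exact: cr_near_cst|lra].
Qed.

Lemma cr_ltW x y : cr_lt x y -> cr_le x y.
Proof.
move=> [r0 /slt0P r0P [n0 h0]] r /slt0P rP; exists n0 => n n0n.
apply/sltP => b p q b0 bp bq.
have [t [c [c0 cb rt <-]]] := step_of_force b0 bp.
have [t0 [d [d0 dc r0t]]] := part_eval (r0 : step A R) c0.
have /sltP/(_ d t0 q d0 r0t (le_trans dc (le_trans cb bq))) := h0 n n0n.
by have := rP c t c0 rt; have := r0P d t0 d0 r0t; lra.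
Qed.

(** Replaces a conditional tolerance by real ones, one on each piece of the partition [N], so that
    limits, Cauchy sequences and density can be tested with constants. *)
Lemma cr_lt_invn r : cr_lt (cr0 R A) r -> exists N : condnat A, forall x,
  cr_le x (concat (N : step A nat) (fun k => cst (invn R k))) -> cr_lt x r.
Proof.
move=> r0.
have r0' : cauchy_lt (cauchy_cst (scst A 0%R)) (repr (r : creal R A)).
  by apply/cr_lt_pi; rewrite reprK.
(* The factor 2 leaves room for a strict inequality and for the approximation errors of [x] and
   [r]. *)
have [d d' k dd' Pd|b b0|N hN] := @mix_nat A (fun d k => forall c u e,
    \bot < c -> c <= d -> cr_near r c u e -> (2 * invn R k <= u + e)%R).
- by move=> c u e c0 cd'; apply: Pd => //; exact: le_trans dd'.
- have [d [k [d0 db dk]]] := cauchy_gt0_local r0' b0.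
  have k2 : (0 < invn R k / 2)%R by have := invn_gt0 R k; lra.
  have [j jk] := invn_small k2.
  exists d, j; split=> // c u e c0 cd ru.
  by have := dk c u e c0 cd ru; lra.
exists N => x xN; apply: cauchy_ltI => b b0.
have [k [c [c0 cb cN]]] := part_eval (N : step A nat) b0.
have [d [d0 dc dP]] := hN k c c0 cN.
have k9 : (0 < invn R k / 9)%R by have := invn_gt0 R k; lra.
have [d1 [v [d10 d1d [xv [rv _]]]]] := cr_locate_all [:: x; r] k9 d0.
have d1c := le_trans d1d dc.
exists d1, (v x), (v r), (invn R k / 9)%R, (invn R k / 9)%R; split=> //.
  exact: le_trans d1c cb.
have := cr_le_near xN d10 xv
  (cr_near_concat (le_trans d1c cN) (cr_near_cst (invn R k) d1)).
by have := dP d1 _ _ d10 d1d rv; lra.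
Qed.

(** Each [u k] is approximated up to [invn R k] by a step function [q k], and the [q k] form a
    Cauchy sequence representing the limit. It is within [2 * invn R k] of [q k], whence the
    constant 3. *)
Lemma cr_limit (u : nat -> condreal R A) :
  (forall j k, cr_le (u j) (u k +! cst (invn R j + invn R k)%R)) ->
  exists x, forall k, cr_le (u k) (x +! cst (3 * invn R k)%R) /\
    cr_le x (u k +! cst (3 * invn R k)%R).
Proof.
move=> H.
have /choice[q hq] k := near_approx (repr (u k : creal R A)) (invn_gt0 R k).
have dist j k d w w' : \bot < d -> d <= (q j : step A R) w ->
    d <= (q k : step A R) w' -> (`|w - w'| <= 2 * invn R j + 2 * invn R k)%R.
  move=> d0 /hq jw /hq kw.
  have := cr_le_near (H j k) d0 jw (cr_near_add kw (cr_near_cst _ d)).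
  have := cr_le_near (H k j) d0 kw (cr_near_add jw (cr_near_cst _ d)).
  by rewrite ler_norml => ? ?; apply/andP; split; lra.
have [s sq] : exists s : cauchyseq R A, forall k, s (ncst A k) = q k.
  apply: cauchy_of_nat => e e0; have e4 : (0 < e / 4)%R by lra.
  have [N Ne] := invn_small e4.
  exists N => j k Nj Nk c w w' c0 jw kw; have := dist j k c w w' c0 jw kw.
  by have := invn_le R Nj; have := invn_le R Nk; lra.
pose x : condreal R A := (\pi_(creal R A) s)%qT.
have xnear k d w : d <= (q k : step A R) w -> cr_near x d w (2 * invn R k)%R.
  move=> dw; apply: cr_near_pi => f b f0 b0 bd.
  have f2 : (0 < f / 2)%R by lra.
  (* In the bound of [dist] the term [2 * invn R j] is absorbed by [f] for late [j]; only
     [2 * invn R k] remains. *)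
  have [N Nf] := invn_small f2.
  exists b, N; split=> // j Nj c' w' c'0 c'b; rewrite sq => jw.
  have := dist j k c' w' w c'0 jw (le_trans c'b (le_trans bd dw)).
  by have := invn_le R Nj; lra.
exists x => k; split; apply: cr_leI => d v w e f d0 kv kw;
  have [z [c [c0 cd cz]]] := part_eval (q k : step A R) d0;
  have := cr_near_uniq c0 (cr_near_sub cd kv) _;
  have := cr_near_uniq c0 (cr_near_sub cd kw) _.
  move=> /(_ _ _ (cr_near_add (xnear k c z cz) (cr_near_cst _ c))).
  move=> + /(_ _ _ (hq k c z cz)).
  by rewrite !ler_norml => /andP[? ?] /andP[? ?]; lra.
move=> /(_ _ _ (cr_near_add (hq k c z cz : cr_near _ _ _ _) (cr_near_cst _ c))).
move=> + /(_ _ _ (xnear k c z cz)).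
by rewrite !ler_norml => /andP[? ?] /andP[? ?]; lra.
Qed.

End CondRealTheory.

Local Notation "x +! y" := (cr_add x y) (at level 50, left associativity).

(** * Metric notions tested with constant tolerances *)

Section CondMetric.
Variables (R : realType) (A : cbalg) (X : condmetric R A).
Implicit Types (x y : X) (a b c d : A) (r : condreal R A) (e f : R).
Local Notation cst := (cr_cst A).
Local Notation dist x y := (cm_dist (x, y)).

Lemma dist_restr x y x' y' a : restr x a = restr x' a ->
  restr y a = restr y' a -> restr (dist x y) a = restr (dist x' y') a.
Proof.
move=> xx yy; apply: (stable_restr (@cm_stable _ _ X)).
exact: (f_equal2 pair xx yy).
Qed.

Lemma dist_concat I (p : bpartition A I) (x y : I -> X) :
  dist (concat p x) (concat p y) = concat p (fun i => dist (x i) (y i)).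
Proof. by rewrite -concat_pair (@cm_stable _ _ X). Qed.

Lemma distxx x : dist x x = cr0 R A.
Proof. exact/cm_eq0. Qed.

(** Lets an estimate beyond a concatenated index be checked piece by piece, although [n] exceeds
    [n0 i] only on [p i]. *)
Lemma nle_concat I (p : bpartition A I) (n0 : I -> condnat A) n :
  nle (concat p n0) n ->
  exists2 n', forall i, nle (n0 i) (n' i) & n = concat p n'.
Proof.
move=> h; have /choice[n' hn'] i : exists n', nle (n0 i) n' /\
    step_agree (p i) n n'.
  by have [n' ? ?] := nle_patch i h; exists n'.
exists n' => [i|]; first exact: (hn' i).1.
by apply: concat_uniq => i; apply/condstepE; exact: (hn' i).2.
Qed.

(** The indices found for the tolerances [invn R k] are concatenated along the partition that
    [cr_lt_invn] attaches to [r]; stability of the sequence and of the metric does the rest. *)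
Lemma cm_limit_small (x : condseq X) l :
  (forall e, (0 < e)%R -> exists n0, forall n, nle n0 n ->
     cr_le (dist (x n) l) (cst e)) -> cm_limit x l.
Proof.
move=> H r /cr_lt_invn[N hN].
have /choice[n0 h0] k := H _ (invn_gt0 R k).
exists (concat (N : step A nat) n0) => n /nle_concat[n' n0n' ->].
apply: hN; rewrite (seq_stable x) -[l](concat_cst (N : step A nat)) dist_concat.
by apply: cr_le_concat => k; apply: h0.
Qed.

Lemma cm_cauchy_small (x : condseq X) :
  (forall e, (0 < e)%R -> exists n0, forall m n, nle n0 m -> nle n0 n ->
     cr_le (dist (x m) (x n)) (cst e)) -> cm_cauchy x.
Proof.
move=> H r /cr_lt_invn[N hN].
have /choice[n0 h0] k := H _ (invn_gt0 R k).
exists (concat (N : step A nat) n0) => m n.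
move=> /nle_concat[m' n0m' ->] /nle_concat[n' n0n' ->].
apply: hN; rewrite !(seq_stable x) dist_concat.
by apply: cr_le_concat => k; apply: h0.
Qed.

Lemma cm_dense_small (Y : set X) : stable_subset Y ->
  (forall x e, (0 < e)%R -> exists2 y, Y y & cr_le (dist x y) (cst e)) ->
  cm_dense Y.
Proof.
move=> [_ sY] H x r /cr_lt_invn[N hN].
have /choice[y hy] k : exists y, Y y /\ cr_le (dist x y) (cst (invn R k)).
  by have [y] := H x _ (invn_gt0 R k); exists y.
exists (concat (N : step A nat) y); first by apply: sY => k; exact: (hy k).1.
apply: hN; rewrite -[x](concat_cst (N : step A nat)) dist_concat.
by apply: cr_le_concat => k; exact: (hy k).2.
Qed.

End CondMetric.

(** * Conditional sequences from ordinary ones *)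

Section Sequences.
Variables (A : cbalg) (X : condset A).

Fact natseq_stable (x : nat -> X) :
  stable (fun n : condnat A => concat (n : step A nat) x).
Proof.
apply/stableP => m n a /condstepE mn.
apply: (@restr_part _ _ _ (m : step A nat)) => k.
rewrite (restr_le (leIr _ _) (concatP (m : step A nat) x k)).
have := mn k; rewrite -/(part_fun _ _) meetC [X in _ = X]meetC => ->.
by rewrite (restr_le (leIr _ _) (concatP (n : step A nat) x k)).
Qed.

Definition natseq (x : nat -> X) := CondSeq (natseq_stable x).

End Sequences.

Lemma cr_le_natseq (R : realType) (A : cbalg) (n : condnat A) N :
  nle (ncst A N) n ->
  cr_le (concat (n : step A nat) (fun k => cr_cst A (invn R k)))
    (cr_cst A (invn R N)).
Proof.
move=> Nn; apply: cr_leI => d u v e f d0 nu nv.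
have [k [c [c0 cd cn]]] := part_eval (n : step A nat) d0.
have Nk := nleE Nn c0 (step_cst_ge N c) cn.
have := cr_near_uniq c0 (cr_near_sub cd nu)
  (cr_near_concat cn (cr_near_cst (invn R k) c)).
have := cr_near_uniq c0 (cr_near_sub cd nv) (cr_near_cst (invn R N) c).
have := invn_le R Nk.
by rewrite !ler_norml => ? /andP[? ?] /andP[? ?]; lra.
Qed.

(** * The conditional metric space of Katetov functions *)

Section Katetov.
Variables (R : realType) (A : cbalg) (X : condmetric R A).
Implicit Types (x y : X) (a b c d : A) (e : R).
Local Notation cst := (cr_cst A).
Local Notation dist x y := (cm_dist (x, y)).

(* The functions x |-> d(z, x) for z in the completion. *)
Record katetov := Katetov {
  kat_fun :> X -> condreal R A;
  kat_stable : stable kat_fun;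
  kat_lip : forall x y, cr_le (kat_fun x) (kat_fun y +! dist x y);
  kat_tri : forall x y, cr_le (dist x y) (kat_fun x +! kat_fun y);
  kat_inf : forall e, (0 < e)%R -> exists x, cr_le (kat_fun x) (cst e) }.
Implicit Types f g h : katetov.

Lemma kat_ext f g : (forall x, f x = g x) -> f = g.
Proof.
case: f g => [f f1 f2 f3 f4] [g g1 g2 g3 g4] /= /funext fg; subst g.
by rewrite (Prop_irrelevance f1 g1) (Prop_irrelevance f2 g2)
  (Prop_irrelevance f3 g3) (Prop_irrelevance f4 g4).
Qed.

Section DistTo.
Variables (Z : condmetric R A) (i : X -> Z).
Hypothesis i_iso : cm_isometry i.
Hypothesis i_dense : forall z e, (0 < e)%R -> exists x, cr_le (dist z (i x)) (cst e).

Fact dist_to_stable z : stable (fun x => dist z (i x)).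
Proof.
by apply/stableP => x y a xy; apply: dist_restr => //;
  exact: stable_restr i_iso.1 xy.
Qed.

Fact dist_to_lip z x y : cr_le (dist z (i x)) (dist z (i y) +! dist x y).
Proof. by rewrite -i_iso.2 [dist (i x) _]cm_sym; exact: cm_triangle. Qed.

Fact dist_to_tri z x y : cr_le (dist x y) (dist z (i x) +! dist z (i y)).
Proof. by rewrite -i_iso.2 [dist z (i x)]cm_sym; exact: cm_triangle. Qed.

Definition dist_to z :=
  Katetov (dist_to_stable z) (dist_to_lip z) (dist_to_tri z) (@i_dense z).

End DistTo.

Fact id_iso : cm_isometry (@id X).
Proof. by []. Qed.

Fact id_dense x e : (0 < e)%R -> exists y, cr_le (dist x y) (cst e).
Proof. by move=> e0; exists x; rewrite distxx; exact/cr_ltW/cr_cst_gt0. Qed.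

Definition kat_point := dist_to id_iso id_dense.

Definition kat_agree a f g := forall x, restr (f x) a = restr (g x) a.

Fact kat_inh : inhabited katetov.
Proof. by case: (cs_inhabited X) => x; exists; exact: kat_point x. Qed.

Section Glue.
Variables (I : Type) (p : bpartition A I) (F : I -> katetov).
Let g x := concat p (fun i => F i x).

Fact kat_glue_stable : stable g.
Proof.
apply/stableP => x y a xy; apply: restr_concat => i.
exact: stable_restr (kat_stable (F i)) xy.
Qed.

Fact kat_glue_lip x y : cr_le (g x) (g y +! dist x y).
Proof.
rewrite -[dist x y](concat_cst p) cr_add_concat.
by apply: cr_le_concat => i; exact: kat_lip.
Qed.

Fact kat_glue_tri x y : cr_le (dist x y) (g x +! g y).
Proof.
rewrite -[dist x y](concat_cst p) cr_add_concat.
by apply: cr_le_concat => i; exact: kat_tri.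
Qed.

(** Points where the single [F i] are small are glued along [p]; by stability the glued function
    takes there the concatenation of the small values. *)
Fact kat_glue_inf e : (0 < e)%R -> exists x, cr_le (g x) (cst e).
Proof.
move=> e0; have /choice[x hx] i := kat_inf (F i) e0.
exists (concat p x); rewrite -[cst e](concat_cst p).
suff -> : g (concat p x) = concat p (fun i => F i (x i)) by exact: cr_le_concat.
apply: concat_uniq => i; rewrite /g concatP.
exact: stable_restr (kat_stable _) (concatP _ _ _).
Qed.

Definition kat_glue :=
  Katetov kat_glue_stable kat_glue_lip kat_glue_tri kat_glue_inf.

End Glue.

Fact kat_agree_glue I (p : bpartition A I) (F : I -> katetov) :
  exists! f, forall i, kat_agree (p i) f (F i).
Proof.
exists (kat_glue p F); split=> [i x|f fF]; first exact: (concatP p _ i).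
by apply: kat_ext => x; symmetry; apply: concat_uniq => i; exact: fF.
Qed.

Definition kat_condset : condset A :=
  @condset_of_agree A katetov kat_agree kat_inh (fun a f x => erefl)
    (fun a f g fg x => esym (fg x))
    (fun a f g h fg gh x => etrans (fg x) (gh x))
    (fun a b f g ab fg x => restr_le ab (fg x)) kat_agree_glue.

Lemma kat_restr (f g : kat_condset) a : restr f a = restr g a <->
  forall x, restr ((f : katetov) x) a = restr ((g : katetov) x) a.
Proof. exact: condset_of_agreeE. Qed.

Lemma kat_concat I (p : bpartition A I) (F : I -> kat_condset) x :
  (concat p F : katetov) x = concat p (fun i => (F i : katetov) x).
Proof.
by apply: concat_uniq => i; have /kat_restr := concatP p F i; apply.
Qed.

Fact kat_dist_ex f g : exists r, forall x,
  [/\ cr_le r (f x +! g x), cr_le (f x) (g x +! r) & cr_le (g x) (f x +! r)].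
Proof.
have /choice[z hz] k := kat_inf f (invn_gt0 R k).
have [|r hr] := @cr_limit R A (g \o z).
  (* The values [g (z j)] and [g (z k)] differ by at most the distance of the two points, which is
     at most [f (z j) + f (z k)]. *)
  move=> j k /=; have h1 := kat_lip g (z j) (z k); have h2 := kat_tri f (z j) (z k).
  have h3 := hz j; have h4 := hz k.
  cr_lra [:: g (z j); g (z k); dist (z j) (z k); f (z j); f (z k)].
(* In each bound [r] is replaced by the nearby [g (z k)], and [f (z k)] is nearly zero; the
   inequalities of [f] and [g] between [z k] and [x] give the rest. *)
exists r => x; split; apply: cr_le_arch => e e0;
  have e9 : (0 < e / 9)%R by lra.
- have [k ke] := invn_small e9; have [h1 h2] := hr k; have h3 := hz k.
  have h4 := kat_lip g (z k) x; have h5 := kat_tri f (z k) x.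
  rewrite /= in h1 h2.
  cr_lra [:: r; f x; g x; g (z k); dist (z k) x; f (z k)].
- have [k ke] := invn_small e9; have [h1 h2] := hr k; have h3 := hz k.
  have h4 := kat_lip f x (z k); have h5 := kat_tri g x (z k).
  rewrite /= in h1 h2.
  cr_lra [:: r; f x; g x; g (z k); dist x (z k); f (z k)].
have [k ke] := invn_small e9; have [h1 h2] := hr k; have h3 := hz k.
have h4 := kat_lip g x (z k); have h5 := kat_tri f x (z k).
rewrite /= in h1 h2.
cr_lra [:: r; f x; g x; g (z k); dist x (z k); f (z k)].
Qed.

Definition kat_dist f g := sval (cid (kat_dist_ex f g)).

Lemma kat_dist_le_add f g x : cr_le (kat_dist f g) (f x +! g x).
Proof. by rewrite /kat_dist; case: cid => r /= /(_ x)[]. Qed.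

Lemma kat_lel f g x : cr_le (f x) (g x +! kat_dist f g).
Proof. by rewrite /kat_dist; case: cid => r /= /(_ x)[]. Qed.

Lemma kat_ler f g x : cr_le (g x) (f x +! kat_dist f g).
Proof. by rewrite /kat_dist; case: cid => r /= /(_ x)[]. Qed.

(** A one-sided bound suffices: where [f] is nearly zero, the distance is at most about [g x], hence
    about [r]. *)
Lemma kat_dist_le f g r :
  (forall x, cr_le (g x) (f x +! r)) -> cr_le (kat_dist f g) r.
Proof.
move=> H; apply: cr_le_arch => e e0; have e9 : (0 < e / 9)%R by lra.
have [x hx] := kat_inf f e9; have h1 := kat_dist_le_add f g x; have h2 := H x.
cr_lra [:: kat_dist f g; r; f x; g x].
Qed.

(** Where [f] is nearly zero, [g x] is at most about the distance. With [kat_dist_le] this reduces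
    statements on distances to pointwise ones. *)
Lemma kat_dist_ge f g r :
  (forall x, cr_le r (f x +! g x)) -> cr_le r (kat_dist f g).
Proof.
move=> H; apply: cr_le_arch => e e0; have e9 : (0 < e / 9)%R by lra.
have [x hx] := kat_inf f e9; have h1 := kat_ler f g x; have h2 := H x.
cr_lra [:: kat_dist f g; r; f x; g x].
Qed.

Let D (p : condprod kat_condset kat_condset) : condreal R A := kat_dist p.1 p.2.

Fact kat_dist_stable : stable D.
Proof.
move=> I p F; have -> : concat p F =
    (concat p (fun i => (F i).1), concat p (fun i => (F i).2)).
  by rewrite -concat_pair; congr concat; apply/funext => i; case: (F i).
apply: cr_le_anti; [apply: kat_dist_le|apply: kat_dist_ge] => x;
  rewrite !kat_concat cr_add_concat; apply: cr_le_concat => i.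
  exact: kat_ler.
exact: kat_dist_le_add.
Qed.

Fact kat_dist_ge0 f g : cr_le (cr0 R A) (D (f, g)).
Proof.
have [x] : inhabited X := cs_inhabited X.
have h1 := kat_lel f g x; have h2 := kat_ler f g x.
(* Zero is folded into the constant form that [cr_near_cst] matches. *)
rewrite -/(cr_cst A 0%R) /D /=.
cr_lra [:: kat_dist f g; f x; g x].
Qed.

Fact kat_dist_eq0 f g : D (f, g) = cr0 R A <-> f = g.
Proof.
split=> [fg|->].
  apply: kat_ext => x; have h1 := kat_lel f g x; have h2 := kat_ler f g x.
  rewrite [kat_dist f g]fg -/(cr_cst A 0%R) in h1 h2.
  by apply: cr_le_anti; cr_lra [:: f x; g x].
apply: cr_le_anti; last exact: kat_dist_ge0.
apply: kat_dist_le => x; rewrite -/(cr_cst A 0%R).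
cr_lra [:: g x].
Qed.

Fact kat_dist_sym f g : D (f, g) = D (g, f).
Proof.
by apply: cr_le_anti; apply: kat_dist_le => x; exact: kat_lel.
Qed.

Fact kat_dist_triangle f g h : cr_le (D (f, g)) (D (f, h) +! D (h, g)).
Proof.
apply: kat_dist_le => x; rewrite /D /=.
have h1 := kat_ler f h x; have h2 := kat_ler h g x.
cr_lra [:: f x; g x; h x; kat_dist f h; kat_dist h g].
Qed.

Definition kat_metric : condmetric R A :=
  CondMetric kat_dist_stable kat_dist_ge0 kat_dist_eq0 kat_dist_sym
    kat_dist_triangle.

Lemma kat_metricE f g : cm_dist ((f, g) : kat_metric * kat_metric) = kat_dist f g.
Proof. by []. Qed.

End Katetov.

(** * Completeness, density and surjectivity *)

Section Completion.
Variables (R : realType) (A : cbalg) (X : condmetric R A).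
Implicit Types (x y : X) (a b c d : A) (e : R).
Local Notation cst := (cr_cst A).
Local Notation dist x y := (cm_dist (x, y)).
Local Notation Xc := (kat_metric X).

Section DistTo.
Variables (Z : condmetric R A) (i : X -> Z).
Hypothesis i_iso : cm_isometry i.
Hypothesis i_dense : forall z e, (0 < e)%R -> exists x, cr_le (dist z (i x)) (cst e).
Let psi : Z -> Xc := dist_to i_iso i_dense.

Lemma dist_to_isometry : cm_isometry psi.
Proof.
split=> [|z w].
  apply/stableP => z w a zw; apply/kat_restr => x; exact: dist_restr.
rewrite kat_metricE; apply: cr_le_anti.
  apply: kat_dist_le => x; rewrite /= cm_sym.
  have h := cm_triangle w (i x) z; rewrite [dist w z]cm_sym in h.
  rewrite [dist (i x) w]cm_sym.
  cr_lra [:: dist w (i x); dist z (i x); dist z w].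
apply: kat_dist_ge => x /=; rewrite [dist w (i x)]cm_sym; exact: cm_triangle.
Qed.

(** Points where [f] is nearly zero are close to each other by [kat_tri]; the limit in [Z] of their
    images is the point whose distance function is [f]. *)
Lemma dist_to_surj : cm_complete Z -> forall f : Xc, exists z, psi z = f.
Proof.
move=> Z_complete f; pose F : katetov X := f.
have /choice[x hx] k := kat_inf F (invn_gt0 R k).
have Fx e : (0 < e)%R -> exists n0, forall n, nle n0 n ->
    cr_le (F (natseq x n)) (cst e).
  move=> /invn_small[N Ne]; exists (ncst A N) => n Nn.
  rewrite /= (kat_stable F).
  have h1 : cr_le (concat (n : step A nat) (fun k => F (x k)))
    (concat (n : step A nat) (fun k => cst (invn R k))).
    by apply: cr_le_concat => k; exact: hx.
  have h2 := @cr_le_natseq R _ _ _ Nn; have h3 := cr_le_trans h1 h2.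
  cr_lra [:: concat (n : step A nat) (fun k => F (x k))].
pose y := natseq (i \o x).
have yE n : y n = i (natseq x n) by rewrite /= i_iso.1.
have [|z zy] := Z_complete y.
  apply: cm_cauchy_small => e e0; have e2 : (0 < e / 2)%R by lra.
  have [n0 h0] := Fx _ e2; exists n0 => m n n0m n0n.
  rewrite !yE i_iso.2.
  have h1 := h0 m n0m; have h2 := h0 n n0n.
  have h3 := kat_tri F (natseq x m) (natseq x n).
  cr_lra [:: dist (natseq x m) (natseq x n); F (natseq x m); F (natseq x n)].
exists z; apply: kat_ext => w /=.
(* Such a [v] has its image near [z] and a small value [F v], so both [F w] and the distance from
   [z] to [i w] are close to the distance from [v] to [w]. *)
have near_z e : (0 < e)%R -> exists v : X,
    cr_le (F v) (cst e) /\ cr_le (dist (i v) z) (cst e).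
  move=> e0; have [n0 h0] := Fx _ e0; have [n1 h1] := zy _ (cr_cst_gt0 A e0).
  exists (natseq x (nmax n0 n1)); split; first exact/h0/nle_maxl.
  by rewrite -yE; apply/cr_ltW/h1/nle_maxr.
apply: cr_le_anti; apply: cr_le_arch => e e0; have e9 : (0 < e / 9)%R by lra.
  have [v [h1 h2]] := near_z _ e9.
  have h3 := cm_triangle z (i w) (i v); have h4 := kat_tri F v w.
  rewrite [dist z (i v)]cm_sym i_iso.2 in h3; rewrite -/F.
  cr_lra [:: dist z (i w); F w; F v; dist v w; dist (i v) z].
have [v [h1 h2]] := near_z _ e9.
have h3 := cm_triangle (i w) (i v) z; have h4 := kat_lip F w v.
rewrite i_iso.2 [dist (i w) z]cm_sym [dist z (i v)]cm_sym in h3; rewrite -/F.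
cr_lra [:: dist z (i w); F w; F v; dist w v; dist (i v) z].
Qed.

End DistTo.

Let pt : X -> Xc := kat_point (X := X).

(** The upper bound is [kat_tri] and the lower one [kat_lip]. Density of the image of [pt] then
    amounts to [kat_inf]. *)
Lemma kat_dist_point (f : Xc) x : dist f (pt x) = (f : katetov X) x.
Proof.
rewrite kat_metricE; apply: cr_le_anti.
  apply: kat_dist_le => y /=; have h := kat_tri (f : katetov X) x y.
  cr_lra [:: dist x y; (f : katetov X) x; (f : katetov X) y].
by apply: kat_dist_ge => y; exact: kat_lip.
Qed.

(** An ordinary sequence [f k] of terms at Cauchy indices converges pointwise at a rate independent
    of the point. The limit inherits the Katetov conditions up to arbitrary real errors, and the
    conditional sequence follows by the Cauchy property. *)
Lemma kat_complete : cm_complete Xc.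
Proof.
move=> F cF.
have cF' k : exists n0, forall m n, nle n0 m -> nle n0 n ->
    cr_le (dist (F m) (F n)) (cst (invn R k)).
  have [n0 h0] := cF _ (cr_cst_gt0 A (invn_gt0 R k)).
  by exists n0 => m n n0m n0n; apply: cr_ltW; exact: h0.
have /choice[n0 h0] := cF'; pose f k : katetov X := F (n0 k).
have ff j k : cr_le (kat_dist (f j) (f k)) (cst (invn R j + invn R k)%R).
  (* The term at a common later index is close to both [f j] and [f k]. *)
  pose n := nmax (n0 j) (n0 k).
  have h1 := h0 j _ n (@nle_refl _ _) (@nle_maxl _ _ _).
  have h2 := h0 k n _ (@nle_maxr _ _ _) (@nle_refl _ _).
  have h3 := cm_triangle (F (n0 j)) (F (n0 k)) (F n).
  rewrite -kat_metricE.
  cr_lra [:: dist (F (n0 j)) (F (n0 k)); dist (F (n0 j)) (F n);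
    dist (F n) (F (n0 k))].
have /choice[g hg] x : exists r, forall k,
    cr_le (f k x) (cr_add r (cst (3 * invn R k)%R)) /\
    cr_le r (cr_add (f k x) (cst (3 * invn R k)%R)).
  apply: cr_limit => j k; have h1 := ff j k; have h2 := kat_lel (f j) (f k) x.
  cr_lra [:: f j x; f k x; kat_dist (f j) (f k)].
have g_approx e : (0 < e)%R -> exists k, (invn R k < e)%R /\ forall x,
    cr_le (f k x) (cr_add (g x) (cst e)) /\ cr_le (g x) (cr_add (f k x) (cst e)).
  move=> e0; have e3 : (0 < e / 3)%R by lra.
  have [k ke] := invn_small e3; exists k; split=> [|x]; first by lra.
  have [h1 h2] := hg x k.
  by split; cr_lra [:: g x; f k x].
(* Both sides are compared with those of a stable [f k] that is uniformly close to [g];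
   concatenation preserves the estimate. *)
have g_stable : stable g.
  move=> I p x; apply: cr_le_anti; apply: cr_le_arch => e e0;
    have e9 : (0 < e / 9)%R by lra.
    have [k [_ hk]] := g_approx _ e9; have [_ h1] := hk (concat p x).
    rewrite (kat_stable (f k)) in h1.
    have h2 : cr_le (concat p (fun i => f k (x i)))
        (concat p (fun i => cr_add (g (x i)) (cst (e / 9)%R))).
      by apply: cr_le_concat => i; exact: (hk (x i)).1.
    rewrite -cr_add_concat concat_cst in h2.
    cr_lra [:: g (concat p x); concat p (fun i => f k (x i));
    concat p (fun i => g (x i))].
  have [k [_ hk]] := g_approx _ e9; have [h1 _] := hk (concat p x).
  rewrite (kat_stable (f k)) in h1.
  have h2 : cr_le (concat p (fun i => g (x i)))
      (concat p (fun i => cr_add (f k (x i)) (cst (e / 9)%R))).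
    by apply: cr_le_concat => i; exact: (hk (x i)).2.
  rewrite -cr_add_concat concat_cst in h2.
  cr_lra [:: g (concat p x); concat p (fun i => f k (x i));
    concat p (fun i => g (x i))].
have g_lip x y : cr_le (g x) (cr_add (g y) (dist x y)).
  apply: cr_le_arch => e e0; have e9 : (0 < e / 9)%R by lra.
  have [k [_ hk]] := g_approx _ e9; have [_ h1] := hk x; have [h2 _] := hk y.
  have h3 := kat_lip (f k) x y.
  cr_lra [:: g x; g y; dist x y; f k x; f k y].
have g_tri x y : cr_le (dist x y) (cr_add (g x) (g y)).
  apply: cr_le_arch => e e0; have e9 : (0 < e / 9)%R by lra.
  have [k [_ hk]] := g_approx _ e9; have [h1 _] := hk x; have [h2 _] := hk y.
  have h3 := kat_tri (f k) x y.
  cr_lra [:: g x; g y; dist x y; f k x; f k y].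
have g_inf e : (0 < e)%R -> exists x, cr_le (g x) (cst e).
  move=> e0; have e9 : (0 < e / 9)%R by lra.
  have [k [_ hk]] := g_approx _ e9; have [x hx] := kat_inf (f k) e9.
  have [_ h1] := hk x; exists x; cr_lra [:: g x; f k x].
pose G : Xc := Katetov g_stable g_lip g_tri g_inf.
exists G; apply: cm_limit_small => e e0; have e9 : (0 < e / 9)%R by lra.
(* Beyond [n0 k] all terms are close to [F (n0 k)], which is close to [G]. *)
have [k [ke hk]] := g_approx _ e9; exists (n0 k) => n n0n.
have h1 := h0 k n _ n0n (@nle_refl _ _).
have h2 : cr_le (dist (F (n0 k)) G) (cst (e / 9)%R).
  by apply: kat_dist_le => x; exact: (hk x).2.
have h3 := cm_triangle (F n) G (F (n0 k)).
cr_lra [:: dist (F n) G; dist (F n) (F (n0 k)); dist (F (n0 k)) G].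
Qed.

Lemma isometry_range_stable (Z : condmetric R A) (i : X -> Z) :
  cm_isometry i -> stable_subset (range i).
Proof.
move=> [si _]; split; first by have [x] := cs_inhabited X; exists (i x), x.
move=> I p z iz; have /choice[x hx] k : exists x, i x = z k.
  by have [x _ xz] := iz k; exists x.
exists (concat p x) => //; rewrite si; congr concat; exact/funext.
Qed.

Lemma isometric_range (Z : condmetric R A) (i : X -> Z) (ii : cm_isometry i) :
  cm_isometric X (cm_subspace (isometry_range_stable ii)).
Proof.
pose j x : cm_subspace (isometry_range_stable ii) :=
  exist _ (i x) (ex_intro2 _ _ x I erefl).
exists j; split; first split=> [|x y].
- apply/stableP => x y a xy; exact: stable_restr ii.1 xy.
- exact: ii.2.
by move=> [z [x ? xz]]; exists x; exact: eq_exist.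
Qed.

Lemma kat_completion : cm_completion X Xc.
Proof.
have pt_iso : cm_isometry pt := dist_to_isometry (id_iso X) (@id_dense _ _ X).
split; first exact: kat_complete.
exists (range pt), (isometry_range_stable pt_iso); split;
  last exact: isometric_range.
apply: cm_dense_small => [|f e e0]; first exact: isometry_range_stable.
have [x hx] := kat_inf (f : katetov X) e0.
by exists (pt x); [exists x|rewrite kat_dist_point].
Qed.

End Completion.

(** * Existence and uniqueness of the completion *)

Lemma isometric_sym (R : realType) (A : cbalg) (X Y : condmetric R A) :
  cm_isometric X Y -> cm_isometric Y X.
Proof.
move=> [f [[sf df] f_surj]]; have /choice[g fg] := f_surj.
have f_inj x y : f x = f y -> x = y.
  by move=> xy; apply/cm_eq0; rewrite -df; apply/cm_eq0.
exists g; split; first split.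
- move=> I p y; apply: f_inj; rewrite fg sf.
  by congr concat; apply/funext => i; rewrite fg.
- by move=> x y; rewrite -df !fg.
by move=> x; exists (f x); apply: f_inj; rewrite fg.
Qed.

Theorem theorem2p4 (R : realType) (A : cbalg) (X : condmetric R A) :
  exists Xc : condmetric R A,
    cm_completion X Xc /\
    forall Xc' : condmetric R A, cm_completion X Xc' -> cm_isometric Xc Xc'.
Proof.
exists (kat_metric X); split; first exact: kat_completion.
move=> Z [Z_complete [Y [sY [Y_dense [j [[sj dj] j_surj]]]]]].
pose i x : Z := sval (j x).
have i_iso : cm_isometry i.
  split=> [|x y]; last exact: dj.
  by move=> I p x; rewrite /i sj val_concat.
have i_dense z e : (0 < e)%R -> exists x, cr_le (cm_dist (z, i x)) (cr_cst A e).
  move=> e0; have [y Yy zy] := Y_dense z _ (cr_cst_gt0 A e0).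
  have [x xy] := j_surj (exist _ y Yy).
  by exists x; apply: cr_ltW; rewrite /i xy.
(* Distance functions lead from the given completion [Z] to the Katetov space, opposite to the
   direction asked for. *)
apply: isometric_sym; exists (dist_to i_iso i_dense).
split; [exact: dist_to_isometry|exact: dist_to_surj].
Qed.
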